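(* Let $q\in(0,1)$ and let $\ell^1(h)$ be the $L^1$-algebra associated with the little $q$-Legendre polynomials $(R_n(x;q))_{n\in\mathbb{N}_0}$. Then $\ell^1(h)$ is weakly amenable, i.e. every bounded derivation from $\ell^1(h)$ into its dual module is an inner derivation.
   Context: For $q\in(0,1)$, the little $q$-Legendre polynomials are defined by $R_0(x;q)=1$, $R_1(x;q)=(x-b_0)/a_0$ and $R_1(x;q)R_n(x;q)=a_nR_{n+1}(x;q)+b_nR_n(x;q)+c_nR_{n-1}(x;q)$ for $n\ge1$, where $a_0=\frac{1}{q+1}$, $b_0=\frac{q}{q+1}$, and for $n\ge1$: $a_n=q^n\frac{(1+q)(1-q^{n+1})}{(1-q^{2n+1})(1+q^{n+1})}$, $c_n=q^n\frac{(1+q)(1-q^n)}{(1-q^{2n+1})(1+q^n)}$, $b_n=1-a_n-c_n$. One has linearization formulas $R_m(x;q)R_n(x;q)=\sum_{k=|m-n|}^{m+n}g(m,n;k)R_k(x;q)$ with $g(m,n;k)\ge0$. Let $h(n)=\frac{1}{q^n}\frac{1-q^{2n+1}}{1-q}$. For $f:\mathbb{N}_0\to\mathbb{C}$ let $T_nf(m)=\sum_{k=|m-n|}^{m+n}g(m,n;k)f(k)$. The space $\ell^1(h)=\{f:\mathbb{N}_0\to\mathbb{C}:\sum_k|f(k)|h(k)<\infty\}$ with the convolution $f\ast g(n)=\sum_{k=0}^\infty T_nf(k)g(k)h(k)$ is a commutative unital Banach algebra; its dual module is $\ell^\infty$, on which $\ell^1(h)$ acts by the same convolution formula. A derivation $D:A\to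 X$ into a Banach $A$-bimodule satisfies $D(ab)=a\cdot D(b)+D(a)\cdot b$; it is inner if $D(a)=a\cdot x-x\cdot a$ for some $x\in X$ (for the commutative algebra $\ell^1(h)$ acting on $\ell^\infty$, inner derivations are zero). *)

(* Defs.v *)
From Stdlib Require Import Reals Lra Lia.
From Coquelicot Require Import Coquelicot.
Open Scope R_scope.

Definition la (q : R) (n : nat) : R :=
  match n with
  | O => 1 / (q + 1)
  | _ => q ^ n * ((1 + q) * (1 - q ^ (S n))) / ((1 - q ^ (2 * n + 1)) * (1 + q ^ (S n)))
  end.

(* c_0 never occurs in the recurrence; it is set to 0. *)
Definition lc (q : R) (n : nat) : R :=
  match n with
  | O => 0
  | _ => q ^ n * ((1 + q) * (1 - q ^ n)) / ((1 - q ^ (2 * n + 1)) * (1 + q ^ n))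
  end.

Definition lb (q : R) (n : nat) : R :=
  match n with
  | O => q / (q + 1)
  | _ => 1 - la q n - lc q n
  end.

(* Rpair q n x = (R_n(x;q), R_{n+1}(x;q)) *)
Fixpoint Rpair (q : R) (n : nat) (x : R) : R * R :=
  match n with
  | O => (1, (x - lb q 0) / la q 0)
  | S m =>
      let (u, v) := Rpair q m x in
      (v, (((x - lb q 0) / la q 0) * v - lb q (S m) * v - lc q (S m) * u) / la q (S m))
  end.

Definition Rleg (q : R) (n : nat) (x : R) : R := fst (Rpair q n x).

Definition natdist (m n : nat) : nat := (m - n + (n - m))%nat.

Definition is_linearization (q : R) (g : nat -> nat -> nat -> R) : Prop :=
  forall (m n : nat) (x : R),
    Rleg q m x * Rleg q n x =
    sum_n_m (fun k => g m n k * Rleg q k x) (natdist m n) (m + n).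

Definition hw (q : R) (n : nat) : R := (1 - q ^ (2 * n + 1)) / (q ^ n * (1 - q)).

Definition Tr (g : nat -> nat -> nat -> R) (n : nat) (f : nat -> C) (m : nat) : C :=
  sum_n_m (fun k => Cmult (RtoC (g m n k)) (f k)) (natdist m n) (m + n).

(* value of a complex series (componentwise; the true sum whenever it converges) *)
Definition csum (u : nat -> C) : C :=
  (Series (fun k => fst (u k)), Series (fun k => snd (u k))).

Definition conv (q : R) (g : nat -> nat -> nat -> R) (f1 f2 : nat -> C) (n : nat) : C :=
  csum (fun k => Cmult (Cmult (Tr g n f1 k) (f2 k)) (RtoC (hw q k))).

Definition in_l1 (q : R) (f : nat -> C) : Prop :=
  ex_series (fun k => Cmod (f k) * hw q k).

Definition l1norm (q : R) (f : nat -> C) : R :=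
  Series (fun k => Cmod (f k) * hw q k).

Definition in_linf (phi : nat -> C) : Prop :=
  exists M : R, forall k, Cmod (phi k) <= M.

Definition lact q g (f phi : nat -> C) : nat -> C := conv q g f phi.
Definition ract q g (phi f : nat -> C) : nat -> C := conv q g f phi.

Definition bounded_derivation (q : R) (g : nat -> nat -> nat -> R)
  (D : (nat -> C) -> (nat -> C)) : Prop :=
  (forall f, in_l1 q f -> in_linf (D f)) /\
  (forall f1 f2, in_l1 q f1 -> in_l1 q f2 ->
     forall n, D (fun k => Cplus (f1 k) (f2 k)) n = Cplus (D f1 n) (D f2 n)) /\
  (forall (c : C) f, in_l1 q f ->
     forall n, D (fun k => Cmult c (f k)) n = Cmult c (D f n)) /\
  (exists K : R, forall f, in_l1 q f -> forall n, Cmod (D f n) <= K * l1norm q f) /\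
  (forall f1 f2, in_l1 q f1 -> in_l1 q f2 ->
     forall n, D (conv q g f1 f2) n =
       Cplus (lact q g f1 (D f2) n) (ract q g (D f1) f2 n)).

Definition inner_derivation (q : R) (g : nat -> nat -> nat -> R)
  (D : (nat -> C) -> (nat -> C)) : Prop :=
  exists x : nat -> C, in_linf x /\
    forall f, in_l1 q f -> forall n,
      D f n = Cminus (lact q g f x n) (ract q g x f n).

Definition weakly_amenable (q : R) (g : nat -> nat -> nat -> R) : Prop :=
  forall D, bounded_derivation q g D -> inner_derivation q g D.

(* Main.v *)
(** Write p n k = R_n(1 - q^k).  For fixed k the sequence alpha_k = (p n k)_n
    lies in l^1(h), and by linearization conv alpha_k psi = <psi, alpha_k> alpha_k;
    so alpha_k is a multiple of an idempotent, and every derivation kills it.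
    It remains to see that a bounded sequence phi annihilating all alpha_k is
    constant: then D f n only depends on f through its value at the trivial
    character x = 1, and D vanishes because it kills the unit.

    The key tool is the q-difference equation of p in k, which follows by induction
    on n from a first-order shift relation.  It gives a uniform bound on p n k,
    the decay of alpha_k, and a telescoping formula for the sum over k <= N of
    q^k p n k.  If phi annihilates all alpha_k, so does
    its image psi under R_1 - 1 acting by the recurrence, and h psi is bounded;
    summing q^k <psi, alpha_k> = 0 over k <= N and letting N tend to infinity
    (dominated convergence) leaves psi 0 = 0, that is phi 1 = phi 0. *)

Require Import Defs.
From Stdlib Require Import Reals Lra Lia FunctionalExtensionality.
From Coquelicot Require Import Coquelicot.
Open Scope R_scope.

(** * Sums and series of real and complex numbers *)

Lemma sum_n_S (u : nat -> R) (N : nat) : sum_n u (S N) = sum_n u N + u (S N) :> R.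
Proof. exact (sum_Sn u N). Qed.

Lemma sum_n_0 (u : nat -> R) : sum_n u 0 = u 0%nat :> R.
Proof. exact (sum_O u). Qed.

Lemma sum_n_ext_R (a b : nat -> R) (N : nat) :
  (forall n, a n = b n) -> sum_n a N = sum_n b N :> R.
Proof. exact (sum_n_ext a b N). Qed.

Lemma sum_n_scal_r (a : nat -> R) (c : R) (N : nat) :
  sum_n (fun k => a k * c) N = sum_n a N * c :> R.
Proof. exact (sum_n_mult_r (K := R_Ring) c a N). Qed.

Lemma Series_single (a : nat) (u : nat -> R) :
  (forall m, m <> a -> u m = 0) -> Series u = u a.
Proof.
intros H. apply is_series_unique.
assert (Z : forall N, (N < a)%nat -> sum_n u N = 0).
{ intros N HN. induction N as [|N IH].
  - rewrite sum_n_0. apply H. lia.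
  - rewrite sum_n_S, IH, H by lia. apply Rplus_0_l. }
change (is_lim_seq (sum_n u) (u a)). apply (is_lim_seq_incr_n (sum_n u) a).
apply is_lim_seq_ext with (fun _ => u a); [|apply is_lim_seq_const].
intros n. induction n as [|n IH].
- simpl. destruct a as [|a]; [now rewrite sum_n_0|].
  rewrite sum_n_S, Z by lia. symmetry; apply Rplus_0_l.
- simpl. rewrite sum_n_S, <- IH, (H (S (n + a))) by lia. symmetry; apply Rplus_0_r.
Qed.

Lemma sum_n_m_0_R (u : nat -> R) (a b : nat) :
  (forall j, (a <= j <= b)%nat -> u j = 0) -> sum_n_m u a b = 0 :> R.
Proof.
intros H. rewrite (sum_n_m_ext_loc u (fun _ => zero)) by exact H.
apply (sum_n_m_const_zero (G := R_AbelianMonoid)).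
Qed.

Lemma sum_n_m_head (u : nat -> R) (b : nat) :
  (forall j, u (S j) = 0) -> sum_n_m u 0 b = u 0%nat :> R.
Proof.
intros H. rewrite sum_Sn_m by lia.
transitivity (u 0%nat + 0); [|apply Rplus_0_r].
apply (f_equal (Rplus (u 0%nat))). apply sum_n_m_0_R.
intros [|j] Hj; [lia|apply H].
Qed.

Lemma is_lim_seq_sum_n_m (u : nat -> nat -> R) (l : nat -> R) (a b : nat) :
  (forall j, is_lim_seq (u j) (l j)) ->
  is_lim_seq (fun N => sum_n_m (fun j => u j N) a b) (sum_n_m l a b).
Proof.
intros H. induction b as [|b IH].
- destruct a as [|a].
  + apply is_lim_seq_ext with (u 0%nat); [intros; now rewrite sum_n_n|]. rewrite sum_n_n. apply H.
  + apply is_lim_seq_ext with (fun _ => 0).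
    { intros. symmetry. apply (sum_n_m_zero (G := R_AbelianMonoid)). lia. }
    rewrite (sum_n_m_zero (G := R_AbelianMonoid)) by lia. apply is_lim_seq_const.
- destruct (Nat.le_gt_cases a (S b)) as [L|L].
  + apply is_lim_seq_ext with (fun N => sum_n_m (fun j => u j N) a b + u (S b) N).
    { intros. now rewrite sum_n_Sm. }
    rewrite sum_n_Sm by exact L. apply is_lim_seq_plus'; [exact IH|apply H].
  + apply is_lim_seq_ext with (fun _ => 0).
    { intros. symmetry. apply (sum_n_m_zero (G := R_AbelianMonoid)). lia. }
    rewrite (sum_n_m_zero (G := R_AbelianMonoid)) by lia. apply is_lim_seq_const.
Qed.

(* Tannery's theorem (dominated convergence for series). *)
Lemma is_lim_seq_Series_0 (u : nat -> nat -> R) (b : nat -> R) :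
  (forall N m, Rabs (u N m) <= b m) -> ex_series b ->
  (forall m, is_lim_seq (fun N => u N m) 0) ->
  is_lim_seq (fun N => Series (u N)) 0.
Proof.
intros Hb Eb H. apply is_lim_seq_spec. intros eps.
assert (Eu : forall N, ex_series (u N)).
{ intros N. apply (ex_series_le (V := R_CompleteNormedModule) (u N) b); [intros m; apply Hb|exact Eb]. }
assert (He : 0 < eps / 2) by (destruct eps; simpl; lra).
assert (HB : is_lim_seq (sum_n b) (Series b)) by exact (Series_correct b Eb).
apply is_lim_seq_spec in HB. destruct (HB (mkposreal _ He)) as [M HM].
specialize (HM M (le_n M)). simpl in HM.
pose proof (is_lim_seq_sum_n_m (fun m N => u N m) (fun _ => 0) 0 M H) as HF.
change (is_lim_seq (fun N => sum_n (u N) M) (sum_n (fun _ => 0) M)) in HF. apply is_lim_seq_spec in HF.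
destruct (HF (mkposreal _ He)) as [N0 HN]. exists N0. intros N HN0. specialize (HN N HN0). simpl in HN.
assert (Z : sum_n (fun _ : nat => 0) M = 0).
{ clear. induction M as [|M IH]; [now rewrite sum_n_0|]. rewrite sum_n_S, IH. apply Rplus_0_l. }
rewrite Z, Rminus_0_r in HN. rewrite Rminus_0_r.
(* Both series are split after index [M]: the finite head tends to 0 termwise, and the tail is
   dominated by the tail of [b], which is below eps/2. *)
rewrite (Series_incr_n (u N) (S M)) by (lia || apply Eu). rewrite (Series_incr_n b (S M)) in HM by (lia || exact Eb).
rewrite <- sum_n_Reals in HM. rewrite <- sum_n_Reals. simpl pred in *.
replace (sum_n b M - (sum_n b M + Series (fun k => b (S M + k)%nat))) 
  with (- Series (fun k => b (S M + k)%nat)) in HM by ring.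
rewrite Rabs_Ropp in HM.
assert (T : Rabs (Series (fun k => u N (S M + k)%nat)) <= Series (fun k => b (S M + k)%nat)).
{ assert (E1 : ex_series (fun k => b (S M + k)%nat)) by (apply -> (ex_series_incr_n b (S M)); exact Eb).
  eapply Rle_trans; [apply Series_Rabs|apply Series_le].
  - apply (ex_series_le (V := R_CompleteNormedModule) _ (fun k => b (S M + k)%nat)); [|exact E1].
    intros k. change (Rabs (Rabs (u N (S M + k)%nat)) <= b (S M + k)%nat). rewrite Rabs_Rabsolu. apply Hb.
  - intros k. split; [apply Rabs_pos|apply Hb].
  - exact E1. }
pose proof (Rle_abs (Series (fun k => b (S M + k)%nat))).
eapply Rle_lt_trans; [apply Rabs_triang|]. lra.
Qed.

Lemma ex_series_geom_scal (C q : R) : 0 < q < 1 -> ex_series (fun n => C * q ^ n).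
Proof.
intros Hq. apply (ex_series_scal (V := R_NormedModule) C (fun n => q ^ n)). apply ex_series_geom. rewrite Rabs_pos_eq; lra.
Qed.

Lemma is_series_ext_R (a b : nat -> R) (l : R) :
  (forall n, a n = b n) -> is_series a l -> is_series b l.
Proof. exact (is_series_ext a b l). Qed.

Lemma is_series_plus_0 (a b : nat -> R) :
  is_series a 0 -> is_series b 0 -> is_series (fun n => a n + b n) 0.
Proof.
intros Ha Hb. pose proof (is_series_plus _ _ _ _ Ha Hb) as H.
change (is_series (fun n => a n + b n) (0 + 0)) in H. now rewrite Rplus_0_r in H.
Qed.

Lemma is_series_scal_0 (c : R) (a : nat -> R) :
  is_series a 0 -> is_series (fun n => c * a n) 0.
Proof.
intros Ha. pose proof (is_series_scal c _ _ Ha) as H.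
change (is_series (fun n => c * a n) (c * 0)) in H. now rewrite Rmult_0_r in H.
Qed.

Lemma is_series_0 : is_series (fun _ => 0) 0.
Proof.
change (is_lim_seq (sum_n (fun _ => 0)) 0).
apply is_lim_seq_ext with (fun _ => 0); [|apply is_lim_seq_const].
intros n. symmetry. apply sum_n_m_0_R. reflexivity.
Qed.

Lemma ex_series_finite (u : nat -> R) (N : nat) :
  (forall k, (N < k)%nat -> u k = 0) -> ex_series u.
Proof.
intros H. apply (ex_series_incr_n u (S N)). exists 0.
apply is_series_ext_R with (fun _ => 0); [intros n; rewrite H by lia; ring|apply is_series_0].
Qed.

Lemma is_series_weighted_sum_0 (a : nat -> R) (u : nat -> nat -> R) (N : nat) :
  (forall k, is_series (fun m => u m k) 0) ->
  is_series (fun m => sum_n (fun k => a k * u m k) N) 0.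
Proof.
intros H. induction N as [|N IH].
- apply is_series_ext_R with (fun m => a 0%nat * u m 0%nat); [intros; now rewrite sum_n_0|].
  apply is_series_scal_0, H.
- apply is_series_ext_R with (fun m => sum_n (fun k => a k * u m k) N + a (S N) * u m (S N));
    [intros; now rewrite sum_n_S|].
  apply is_series_plus_0; [exact IH|apply is_series_scal_0, H].
Qed.

Lemma sum_n_m_RtoC (u : nat -> R) (a b : nat) :
  sum_n_m (fun k => RtoC (u k)) a b = RtoC (sum_n_m u a b).
Proof.
induction b as [|b IH].
- destruct a as [|a]; [now rewrite !sum_n_n|]. now rewrite !sum_n_m_zero by lia.
- destruct (Nat.le_gt_cases a (S b)) as [L|L].
  + rewrite !sum_n_Sm, IH by exact L. symmetry. apply RtoC_plus.
  + now rewrite !sum_n_m_zero by lia.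
Qed.

Lemma csum_scal (x : R) (u : nat -> C) : csum (fun k => Cmult (RtoC x) (u k)) = Cmult (RtoC x) (csum u).
Proof.
unfold csum, Cmult; simpl. f_equal.
- rewrite (Series_ext _ (fun k => x * fst (u k))) by (intros; ring). rewrite Series_scal_l. ring.
- rewrite (Series_ext _ (fun k => x * snd (u k))) by (intros; ring). rewrite Series_scal_l. ring.
Qed.

Lemma csum_RtoC_scal (u : nat -> R) (z : C) :
  csum (fun k => Cmult (RtoC (u k)) z) = Cmult (RtoC (Series u)) z.
Proof.
unfold csum, Cmult; simpl. f_equal.
- rewrite (Series_ext _ (fun k => u k * fst z)) by (intros; ring). rewrite Series_scal_r. ring.
- rewrite (Series_ext _ (fun k => u k * snd z)) by (intros; ring). rewrite Series_scal_r. ring.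
Qed.

(** * Recurrence and q-difference equation *)

Section LittleQLegendre.

Context (q : R) (hq : 0 < q < 1).

Lemma qpow_bounds (n : nat) : 0 < q ^ n <= 1.
Proof.
induction n as [|n IH]; simpl; [lra|].
split; [apply Rmult_lt_0_compat; lra|].
apply Rle_trans with (1 * 1); [apply Rmult_le_compat; lra|lra].
Qed.

Lemma qpow_S_lt1 (n : nat) : 0 < q ^ S n < 1.
Proof.
pose proof (qpow_bounds n); split; [apply qpow_bounds|].
simpl; nra.
Qed.

Lemma qpow_double_S (n : nat) : q ^ (2 * n + 1) = q * (q ^ n * q ^ n).
Proof. rewrite pow_add, pow_mult. replace (q ^ 2) with (q * q) by ring. rewrite Rpow_mult_distr; simpl; ring. Qed.

Lemma qpow_half_bound (n : nat) : q * (q ^ n * q ^ n) <= q.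
Proof. pose proof (qpow_bounds n). assert (q ^ n * q ^ n <= 1 * 1) by (apply Rmult_le_compat; lra). nra. Qed.

(** The points 1 - q^k carry the orthogonality measure, with mass proportional to q^k; they
    accumulate at 1, where every R_n equals 1. *)
Definition p (n k : nat) : R := Rleg q n (1 - q ^ k).

(* w n = a_n h(n) = c_(n+1) h(n+1), where a_0 is to be read as 1: in R_1 R_n the
   leading coefficient for n = 0 is 1, not la q 0. *)
Definition w (n : nat) : R := (1 + q) * (1 - q ^ S n) / ((1 - q) * (1 + q ^ S n)).

(** [- lam n] is the eigenvalue of [p n] under the q-difference operator in k; it grows like q^(-n),
    which is the source of all decay in n. *)
Definition lam (n : nat) : R := (1 - q ^ n) * (1 - q ^ S n) / q ^ n.

Lemma hw_pos (n : nat) : 0 < hw q n.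
Proof.
unfold hw. rewrite qpow_double_S.
pose proof (qpow_bounds n). pose proof (qpow_half_bound n).
apply Rdiv_lt_0_compat; nra.
Qed.

Lemma hw_0 : hw q 0 = 1.
Proof. unfold hw; simpl; field; lra. Qed.

Lemma w_0 : w 0 = 1.
Proof. unfold w; simpl; field; lra. Qed.

Lemma w_bounds (n : nat) : 1 <= w n <= (1 + q) / (1 - q).
Proof.
pose proof (qpow_S_lt1 n). unfold w. set (Q := q ^ S n) in *.
assert (HQ : Q <= q) by (unfold Q; simpl; pose proof (qpow_bounds n); nra).
split.
- apply Rmult_le_reg_r with ((1 - q) * (1 + Q)); [nra|].
  unfold Rdiv; rewrite Rmult_assoc, Rinv_l by nra. nra.
- apply Rmult_le_reg_r with ((1 - q) * (1 + Q)); [nra|].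
  unfold Rdiv at 1; rewrite Rmult_assoc, Rinv_l by nra.
  replace ((1 + q) / (1 - q) * ((1 - q) * (1 + Q))) with ((1 + q) * (1 + Q)) by (field; lra).
  nra.
Qed.

Lemma la_S_hw (n : nat) : la q (S n) * hw q (S n) = w (S n).
Proof.
unfold la, hw, w. rewrite qpow_double_S.
pose proof (qpow_S_lt1 n). pose proof (qpow_half_bound (S n)).
change (q ^ S (S n)) with (q * q ^ S n). set (Q := q ^ S n) in *.
field. repeat split; nra.
Qed.

Lemma lc_S_hw (n : nat) : lc q (S n) * hw q (S n) = w n.
Proof.
unfold lc, hw, w. rewrite qpow_double_S.
pose proof (qpow_S_lt1 n). pose proof (qpow_half_bound (S n)).
set (Q := q ^ S n) in *.
field. repeat split; nra.
Qed.

Lemma Rleg_0 (x : R) : Rleg q 0 x = 1.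
Proof. reflexivity. Qed.

Lemma Rleg_1 (y : R) : Rleg q 1 (1 - y) = 1 - (1 + q) * y.
Proof. unfold Rleg, lb, la; simpl. field; lra. Qed.

Lemma Rleg_SS (n : nat) (x : R) :
  Rleg q (S (S n)) x =
  (Rleg q 1 x * Rleg q (S n) x - lb q (S n) * Rleg q (S n) x - lc q (S n) * Rleg q n x) / la q (S n).
Proof.
unfold Rleg. cbn [Rpair]. destruct (Rpair q n x) as [u v] eqn:E. cbn [fst]. reflexivity.
Qed.

Lemma la_S_neq0 (n : nat) : la q (S n) <> 0.
Proof.
intros E. pose proof (la_S_hw n). rewrite E in H. pose proof (w_bounds (S n)). lra.
Qed.

Lemma Rleg_recurrence (n : nat) (x : R) :
  Rleg q 1 x * Rleg q (S n) x =
  la q (S n) * Rleg q (S (S n)) x + lb q (S n) * Rleg q (S n) x + lc q (S n) * Rleg q n x.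
Proof. rewrite Rleg_SS. field. apply la_S_neq0. Qed.

(** Multiplying the recurrence by h and using a_n + b_n + c_n = 1 puts it in divergence form, with
    R_1 - 1 = -(1+q) y on the right. *)
Lemma Rleg_difference (n : nat) (y : R) :
  w (S n) * (Rleg q (S (S n)) (1 - y) - Rleg q (S n) (1 - y))
  - w n * (Rleg q (S n) (1 - y) - Rleg q n (1 - y))
  = - (1 + q) * y * hw q (S n) * Rleg q (S n) (1 - y).
Proof.
pose proof (Rleg_recurrence n (1 - y)) as E. rewrite Rleg_1 in E.
rewrite <- la_S_hw, <- lc_S_hw.
assert (E2 : lb q (S n) = 1 - la q (S n) - lc q (S n)) by reflexivity.
rewrite E2 in E.
replace (- (1 + q) * y * hw q (S n) * Rleg q (S n) (1 - y))
  with (hw q (S n) * ((1 - (1 + q) * y) * Rleg q (S n) (1 - y) - Rleg q (S n) (1 - y))) by ring.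
rewrite E. ring.
Qed.

(* With Q = q^(n+1) and (z)_i the q-Pochhammer symbol, auxV n y is the polynomial
   sum_i (q/Q)_(i-1) (qQ)_(i-1) / (q)_i^2 (q y)^i and auxU n y = auxV n (q y); R_n and
   R_(n+1) are combinations of the two, and the q-hypergeometric equation of auxV
   is aux_shift. *)
Definition auxU (n : nat) (y : R) : R :=
  let Q := q ^ S n in
  (Rleg q n (1 - y) / (1 - Q) - Rleg q (S n) (1 - y) / (1 - / Q)) / (Q - / Q).
Definition auxV (n : nat) (y : R) : R :=
  let Q := q ^ S n in
  (Q * (Rleg q n (1 - y) / (1 - Q)) - Rleg q (S n) (1 - y) / (1 - / Q) / Q) / (Q - / Q).

Lemma Rleg_aux (n : nat) (y : R) :
  Rleg q n (1 - y) = (1 - q ^ S n) * (auxV n y - auxU n y / q ^ S n).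
Proof.
pose proof (qpow_S_lt1 n). unfold auxU, auxV. set (Q := q ^ S n) in *.
field. repeat split; nra.
Qed.

Lemma Rleg_S_aux (n : nat) (y : R) :
  Rleg q (S n) (1 - y) = (1 - / q ^ S n) * (auxV n y - q ^ S n * auxU n y).
Proof.
pose proof (qpow_S_lt1 n). unfold auxU, auxV. set (Q := q ^ S n) in *.
field. repeat split; nra.
Qed.

Lemma Rleg_SS_aux (n : nat) (y : R) :
  Rleg q (S (S n)) (1 - y) =
  Rleg q (S n) (1 - y) +
  (w n * (Rleg q (S n) (1 - y) - Rleg q n (1 - y)) 
  - (1 + q) * y * hw q (S n) * Rleg q (S n) (1 - y)) / w (S n).
Proof.
pose proof (Rleg_difference n y). pose proof (w_bounds (S n)).
replace (w n * (Rleg q (S n) (1 - y) - Rleg q n (1 - y)))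
 with (w (S n) * (Rleg q (S (S n)) (1 - y) - Rleg q (S n) (1 - y)) - - (1 + q) * y * hw q (S n) * Rleg q (S n) (1 - y)) by lra.
field. lra.
Qed.

Lemma auxU_def (n : nat) (y : R) : auxU n y =
  (Rleg q n (1 - y) / (1 - q ^ S n) - Rleg q (S n) (1 - y) / (1 - / q ^ S n)) / (q ^ S n - / q ^ S n).
Proof. reflexivity. Qed.

Lemma auxV_def (n : nat) (y : R) : auxV n y =
  (q ^ S n * (Rleg q n (1 - y) / (1 - q ^ S n)) - Rleg q (S n) (1 - y) / (1 - / q ^ S n) / q ^ S n)
  / (q ^ S n - / q ^ S n).
Proof. reflexivity. Qed.

(** In the induction step all values at y and at q y are expressed through [auxU n y] and
    [auxV n y], the latter by the induction hypothesis solved for [auxU n (q * y)]. What remains are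
    rational identities, linear in these two values. *)
Lemma aux_shift (n : nat) (y : R) : 1 - q * y <> 0 ->
  auxV n (q * y) = auxU n y /\
  (1 - q * y) * auxU n (q * y) =
    (2 - q * y * (q ^ S n + / q ^ S n)) * auxU n y - (1 - q * y) * auxV n y.
Proof.
intros Hy. induction n as [|n [IHV IHU]].
- unfold auxU, auxV. rewrite !Rleg_0, !Rleg_1. split; simpl; field; repeat split; try nra.
- assert (EU : auxU n (q * y) =
    ((2 - q * y * (q ^ S n + / q ^ S n)) * auxU n y - (1 - q * y) * auxV n y) / (1 - q * y))
    by (rewrite <- IHU; field; exact Hy).
  clear IHU.
  rewrite !(auxU_def (S n)), !(auxV_def (S n)).
  rewrite !Rleg_SS_aux, !Rleg_S_aux, !Rleg_aux, IHV, EU.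
  generalize (auxU n y) (auxV n y). intros u v.
  unfold w, hw. rewrite qpow_double_S.
  pose proof (qpow_S_lt1 n). pose proof (qpow_half_bound (S n)). pose proof (qpow_half_bound (S (S n))).
  change (q ^ S (S (S n))) with (q * (q * q ^ S n)).
  change (q ^ S (S n)) with (q * q ^ S n) in *. set (Q := q ^ S n) in *.
  split; field; repeat split; nra.
Qed.

(** So R_n(0) = (-1)^n q^(n(n+1)/2). This ratio is exactly what makes [auxV n 1] vanish, the
    boundary condition at k = 0. *)
Lemma Rleg_at_0 (n : nat) : Rleg q (S n) (1 - 1) = - q ^ S n * Rleg q n (1 - 1).
Proof.
induction n as [|n IH].
- rewrite Rleg_1, Rleg_0. simpl; ring.
- rewrite Rleg_SS_aux, IH. unfold w, hw. rewrite qpow_double_S.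
  pose proof (qpow_S_lt1 n). pose proof (qpow_half_bound (S n)).
  change (q ^ S (S n)) with (q * q ^ S n). set (Q := q ^ S n) in *.
  field; repeat split; nra.
Qed.

Lemma p_0 (k : nat) : p 0 k = 1.
Proof. reflexivity. Qed.

Lemma lam_0 : lam 0 = 0.
Proof. unfold lam; simpl; field. Qed.

(** The equation of [p_qdifference_S] at index 0: the difference to the previous point carries the
    factor 1 - q^0 = 0. *)
Lemma p_qdifference_0 (n : nat) :
  - lam n * p n 0 = (1 - q) * (p n 1 - p n 0).
Proof.
unfold p. rewrite (Rleg_aux n (q ^ 0)), (Rleg_aux n (q ^ 1)).
assert (V0 : auxV n (q ^ 0) = 0).
{ rewrite auxV_def. simpl (q ^ 0). rewrite Rleg_at_0. pose proof (qpow_S_lt1 n).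
  set (Q := q ^ S n) in *. field; repeat split; nra. }
destruct (aux_shift n (q ^ 0)) as [HV HU]; [simpl; lra|].
assert (HU' : auxU n (q * q ^ 0) =
  (2 - q * (q ^ S n + / q ^ S n)) / (1 - q) * auxU n (q ^ 0)).
{ apply Rmult_eq_reg_l with (1 - q); [|lra].
  replace (1 - q) with (1 - q * q ^ 0) at 1 by (simpl; ring). rewrite HU, V0. simpl (q ^ 0).
  pose proof (qpow_S_lt1 n). field; repeat split; nra. }
change (q ^ 1) with (q * q ^ 0). rewrite HU', HV, V0. unfold lam.
pose proof (qpow_bounds n). change (q ^ S n) with (q * q ^ n).
set (Q := q ^ n) in *. field. lra.
Qed.

(** Two applications of [aux_shift] express the values at y, q y and q^2 y, where y = q^k, through
    [auxU n y] and [auxV n y]; three combinations of two quantities are linearly dependent. *)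
Lemma p_qdifference_S (n k : nat) :
  - lam n * q ^ S k * p n (S k) =
  (1 - q ^ S (S k)) * (p n (S (S k)) - p n (S k)) - (1 - q ^ S k) * (p n (S k) - p n k).
Proof.
unfold p. rewrite (Rleg_aux n (q ^ k)), (Rleg_aux n (q ^ S k)), (Rleg_aux n (q ^ S (S k))).
pose proof (qpow_S_lt1 k). pose proof (qpow_S_lt1 (S k)).
change (q ^ S (S k)) with (q * q ^ S k) in *. change (q ^ S k) with (q * q ^ k) in *.
set (y := q ^ k) in *.
destruct (aux_shift n y) as [HV1 HU1]; [lra|].
destruct (aux_shift n (q * y)) as [HV2 HU2]; [lra|].
rewrite HV2, HV1. rewrite HV1 in HU2.
assert (E1 : auxU n (q * y) =
    ((2 - q * y * (q ^ S n + / q ^ S n)) * auxU n y - (1 - q * y) * auxV n y) / (1 - q * y))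
    by (rewrite <- HU1; field; repeat split; nra).
assert (E2 : auxU n (q * (q * y)) =
    ((2 - q * (q * y) * (q ^ S n + / q ^ S n)) * auxU n (q * y) - (1 - q * (q * y)) * auxU n y)
     / (1 - q * (q * y)))
    by (rewrite <- HU2; field; repeat split; nra).
rewrite E2, E1. unfold lam.
pose proof (qpow_bounds n). change (q ^ S n) with (q * q ^ n).
set (Q := q ^ n) in *. field. lra.
Qed.

(** The q-difference equation is in divergence form in k, and the flux below k = 0 is zero, so only
    the upper end survives. *)
Lemma p_qdifference_sum (n N : nat) :
  lam n * sum_n (fun k => q ^ k * p n k) N = (1 - q ^ S N) * (p n N - p n (S N)).
Proof.
induction N as [|N IH].
- rewrite sum_n_0. pose proof (p_qdifference_0 n). simpl in *; lra.
- rewrite sum_n_S.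
  pose proof (p_qdifference_S n N).
  rewrite Rmult_plus_distr_l, IH. lra.
Qed.

(** The limit is R_n(1) = 1. Induction on consecutive pairs: the term with q^k in the recurrence
    disappears in the limit. *)
Lemma p_lim (n : nat) : is_lim_seq (p n) 1.
Proof.
assert (Hq : is_lim_seq (fun k => q ^ k) 0)
  by (apply is_lim_seq_geom; rewrite Rabs_pos_eq; lra).
enough (H : is_lim_seq (p n) 1 /\ is_lim_seq (p (S n)) 1) by apply H.
induction n as [|n [IH1 IH2]].
- split; [apply is_lim_seq_const|].
  apply is_lim_seq_ext with (fun k => 1 - (1 + q) * q ^ k).
  { intros k. unfold p. now rewrite Rleg_1. }
  replace (Finite 1) with (Finite (1 - (1 + q) * 0)) by (f_equal; ring).
  apply is_lim_seq_minus'; [apply is_lim_seq_const|].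
  apply (is_lim_seq_scal_l _ (1 + q) 0), Hq.
- split; [exact IH2|].
  apply is_lim_seq_ext with (fun k => p (S n) k +
    (w n / w (S n) * (p (S n) k - p n k)
    - (1 + q) * hw q (S n) / w (S n) * (q ^ k * p (S n) k))).
  { intros k. unfold p. rewrite Rleg_SS_aux. pose proof (w_bounds (S n)). field. lra. }
  replace (Finite 1) with (Finite (1 + (w n / w (S n) * (1 - 1) 
    - (1 + q) * hw q (S n) / w (S n) * (0 * 1)))) by (f_equal; ring).
  apply is_lim_seq_plus'; [exact IH2|]. apply is_lim_seq_minus'.
  + apply (is_lim_seq_scal_l _ (w n / w (S n)) (1 - 1)). now apply is_lim_seq_minus'.
  + apply (is_lim_seq_scal_l _ ((1 + q) * hw q (S n) / w (S n)) (0 * 1)). now apply is_lim_seq_mult'.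
Qed.

Lemma p_difference_0 (k : nat) : w 0 * (p 1 k - p 0 k) = - (1 + q) * q ^ k * hw q 0 * p 0 k.
Proof. unfold p. rewrite w_0, hw_0, Rleg_1, Rleg_0. ring. Qed.

Lemma p_difference_S (n k : nat) :
  w (S n) * (p (S (S n)) k - p (S n) k) - w n * (p (S n) k - p n k)
  = - (1 + q) * q ^ k * hw q (S n) * p (S n) k.
Proof. apply Rleg_difference. Qed.

Lemma hw_le (n : nat) : hw q n <= / (1 - q) / q ^ n.
Proof.
unfold hw. pose proof (qpow_bounds n). pose proof (qpow_bounds (2 * n + 1)).
set (Q := q ^ n) in *. set (Z := q ^ _) in *.
apply Rle_trans with (1 / (Q * (1 - q))).
- apply Rmult_le_compat_r; [|lra]. apply Rlt_le, Rinv_0_lt_compat. nra.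
- apply Req_le. field. lra.
Qed.

Lemma hw_ge_1 (n : nat) : 1 <= hw q n.
Proof.
unfold hw. rewrite qpow_double_S. pose proof (qpow_bounds n).
set (Q := q ^ n) in *.
assert (0 < Q * (1 - q)) by nra. assert (0 <= (q * Q) * (1 - Q)) by (repeat apply Rmult_le_pos; lra).
apply Rmult_le_reg_r with (Q * (1 - q)); [assumption|].
unfold Rdiv; rewrite Rmult_assoc, Rinv_l by lra. lra.
Qed.

(** * Bounds *)

(* Gronwall in n: the second-order difference equation is integrated once, and
   the two constants are chosen so that both bounds reproduce themselves. *)
Lemma p_exp_bound (n k : nat) :
  Rabs (p n k) <= exp ((1 + q) / (1 - q) ^ 2 * q / (1 - q) * (q ^ k / q ^ n)).
Proof.
set (c := (1 + q) / (1 - q) ^ 2). set (K := c * q / (1 - q)).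
assert (Hc : 0 < c) by (unfold c; apply Rdiv_lt_0_compat; nra).
assert (HK : 0 < K) by (unfold K; apply Rdiv_lt_0_compat; nra).
(* Passing from n to n+1 turns t = q^k/q^n into t/q. [HcK] says K t/q = K t + c t, so 1 + c t <=
   exp(c t) absorbs the increment of p; [Hcc] says that the new term of the difference equation
   fills the gap between c t and c t/q. *)
assert (HcK : c = K / q - K) by (unfold K; field; repeat split; nra).
assert (Hcc : (1 + q) / (1 - q) = c - c * q) by (unfold c; field; repeat split; nra).
enough (H : Rabs (p n k) <= exp (K * (q ^ k / q ^ n)) /\
  Rabs (w n * (p (S n) k - p n k)) <= c * (q ^ k / q ^ n) * exp (K * (q ^ k / q ^ n))) by apply H.
pose proof (qpow_bounds k) as Hk.
induction n as [|n [IH1 IH2]].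
- rewrite p_difference_0, p_0, hw_0. simpl (q ^ 0). rewrite Rdiv_1_r.
  assert (1 <= exp (K * q ^ k)).
  { rewrite <- exp_0 at 1. apply Rlt_le, exp_increasing. nra. }
  split; [rewrite Rabs_R1; lra|].
  rewrite !Rmult_1_r. replace (- (1 + q) * q ^ k) with (- ((1 + q) * q ^ k)) by ring.
  rewrite Rabs_Ropp, Rabs_pos_eq by nra.
  assert (1 + q <= c).
  { unfold c. apply Rmult_le_reg_r with ((1 - q) ^ 2); [nra|].
    unfold Rdiv; rewrite Rmult_assoc, Rinv_l by nra. nra. }
  apply Rle_trans with (c * q ^ k * 1); [nra|]. apply Rmult_le_compat_l; nra.
- pose proof (qpow_bounds n) as Hn.
  set (t := q ^ k / q ^ n) in *.
  assert (Ht : 0 < t) by (unfold t; apply Rdiv_lt_0_compat; lra).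
  assert (Et : q ^ k / q ^ S n = t / q) by (unfold t; simpl; field; repeat split; nra).
  rewrite Et.
  assert (Htq : t / q * q = t) by (field; repeat split; nra).
  assert (Htq0 : 0 < t / q) by (apply Rdiv_lt_0_compat; lra).
  assert (He : exp (K * t) * (1 + c * t) <= exp (K * (t / q))).
  { replace (K * (t / q)) with (K * t + c * t) by (rewrite HcK; field; repeat split; nra).
    rewrite exp_plus. apply Rmult_le_compat_l; [apply Rlt_le, exp_pos|]. apply Rlt_le, exp_ineq1. nra. }
  assert (P1 : Rabs (p (S n) k) <= exp (K * (t / q))).
  { replace (p (S n) k) with (p n k + (p (S n) k - p n k)) by ring.
    eapply Rle_trans; [apply Rabs_triang|].
    assert (Rabs (p (S n) k - p n k) <= Rabs (w n * (p (S n) k - p n k))).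
    { rewrite Rabs_mult. pose proof (w_bounds n). pose proof (Rabs_pos (p (S n) k - p n k)).
      rewrite (Rabs_pos_eq (w n)) by lra. nra. }
    lra. }
  split; [exact P1|].
  replace (w (S n) * (p (S (S n)) k - p (S n) k)) with
   (w n * (p (S n) k - p n k) + - (1 + q) * q ^ k * hw q (S n) * p (S n) k)
   by (rewrite <- p_difference_S; ring).
  eapply Rle_trans; [apply Rabs_triang|].
  assert (P2 : Rabs (- (1 + q) * q ^ k * hw q (S n) * p (S n) k)
      <= (c - c * q) * (t / q) * exp (K * (t / q))).
  { rewrite Rabs_mult.
    replace (- (1 + q) * q ^ k * hw q (S n)) with (- ((1 + q) * q ^ k * hw q (S n))) by ring.
    pose proof (hw_pos (S n)).
    assert (0 < (1 + q) * q ^ k * hw q (S n))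
      by (apply Rmult_lt_0_compat; [apply Rmult_lt_0_compat; lra|assumption]).
    rewrite Rabs_Ropp, Rabs_pos_eq by lra.
    apply Rmult_le_compat; [lra|apply Rabs_pos| |exact P1].
    rewrite <- Hcc, <- Et. pose proof (hw_le (S n)).
    replace ((1 + q) / (1 - q) * (q ^ k / q ^ S n)) with ((1 + q) * q ^ k * (/ (1 - q) / q ^ S n)).
    - apply Rmult_le_compat_l; nra.
    - field. split; [apply Rgt_not_eq, qpow_bounds|lra]. }
  assert (P3 : c * t * exp (K * t) <= c * q * (t / q) * exp (K * (t / q))).
  { replace (c * q * (t / q)) with (c * t) by (field; repeat split; nra).
    pose proof (Rmult_lt_0_compat c t Hc Ht).
    pose proof (Rmult_lt_0_compat _ _ (exp_pos (K * t)) H).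
    apply Rmult_le_compat_l; lra. }
  lra.
Qed.

Lemma lam_S_ge (n : nat) : (1 - q) ^ 2 / q ^ S n <= lam (S n).
Proof.
unfold lam. pose proof (qpow_bounds n). pose proof (qpow_bounds (S n)).
apply Rmult_le_compat_r; [apply Rlt_le, Rinv_0_lt_compat; lra|].
simpl. assert (0 <= q * q ^ n <= q) by nra. assert (q * (q * q ^ n) <= q) by nra.
rewrite Rmult_1_r. apply Rmult_le_compat; lra.
Qed.

Lemma lam_S_pos (n : nat) : 0 < lam (S n).
Proof.
eapply Rlt_le_trans; [|apply lam_S_ge]. pose proof (qpow_bounds (S n)).
apply Rdiv_lt_0_compat; [nra|lra].
Qed.

(* Where lam n * q^k >= 4, the q-difference equation is a maximum principle which
   forces |p n k| <= |p n (k+1)|; the remaining range is covered by p_exp_bound. *)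
Lemma p_mono (n k : nat) : 4 <= lam n * q ^ k -> Rabs (p n k) <= Rabs (p n (S k)).
Proof.
induction k as [|k IH]; intros H4.
- pose proof (p_qdifference_0 n) as E. simpl (q ^ 0) in H4.
  assert (E2 : (lam n - (1 - q)) * p n 0 = - (1 - q) * p n 1) by lra.
  apply (f_equal Rabs) in E2. rewrite !Rabs_mult, Rabs_Ropp in E2.
  rewrite !(Rabs_pos_eq (_ - _)) in E2 by lra.
  pose proof (Rabs_pos (p n 0)). pose proof (Rabs_pos (p n 1)). nra.
- pose proof (p_qdifference_S n k) as E.
  pose proof (qpow_S_lt1 k). pose proof (qpow_S_lt1 (S k)).
  assert (IH' : Rabs (p n k) <= Rabs (p n (S k))).
  { apply IH. simpl in H4. pose proof (qpow_bounds k).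
    assert (0 < lam n) by (destruct (Rle_or_lt (lam n) 0); [simpl in *; nra|assumption]).
    simpl in *. nra. }
  set (A := 1 - q ^ S (S k)) in *. set (B := 1 - q ^ S k) in *.
  (* The coefficient on the left is at least 2 because A, B <= 1. With the induction hypothesis, 2
     |p n (k+1)| <= |p n (k+2)| + |p n (k+1)|. *)
  assert (E2 : (lam n * q ^ S k - A - B) * p n (S k) = - (A * p n (S (S k)) + B * p n k)) by lra.
  apply (f_equal Rabs) in E2. rewrite Rabs_mult, Rabs_Ropp in E2.
  rewrite (Rabs_pos_eq (_ - _)) in E2 by (unfold A, B; lra).
  pose proof (Rabs_triang (A * p n (S (S k))) (B * p n k)) as T. rewrite !Rabs_mult in T.
  rewrite (Rabs_pos_eq A), (Rabs_pos_eq B) in T by (unfold A, B; lra).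
  pose proof (Rabs_pos (p n k)). pose proof (Rabs_pos (p n (S k))). pose proof (Rabs_pos (p n (S (S k)))).
  assert (A <= 1 /\ B <= 1) by (unfold A, B; lra).
  assert (0 <= A /\ 0 <= B) by (unfold A, B; lra).
  nra.
Qed.

Lemma p_bounded : exists C, 0 < C /\ forall n k, Rabs (p n k) <= C.
Proof.
set (K := (1 + q) / (1 - q) ^ 2 * q / (1 - q)).
assert (HK : 0 < K) by (unfold K; repeat apply Rdiv_lt_0_compat; [apply Rmult_lt_0_compat; [apply Rdiv_lt_0_compat|]|]; nra).
exists (exp (K * (4 / (1 - q) ^ 2))). split; [apply exp_pos|].
intros n k. destruct n as [|n].
- rewrite p_0, Rabs_R1. pose proof exp_0 as E0. rewrite <- E0 at 1. apply Rlt_le, exp_increasing.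
  apply Rmult_lt_0_compat; [exact HK|]. apply Rdiv_lt_0_compat; [lra|apply pow_lt; lra].
- assert (small : forall k, lam (S n) * q ^ k < 4 -> Rabs (p (S n) k) <= exp (K * (4 / (1 - q) ^ 2))).
  { intros j Hj. eapply Rle_trans; [apply p_exp_bound|]. fold K.
    (* By [lam_S_ge] the condition lam * q^j < 4 bounds the argument of the exponential
       independently of n and j. *)
    assert (L : q ^ j / q ^ S n < 4 / (1 - q) ^ 2).
    { pose proof (lam_S_ge n). pose proof (qpow_bounds j). pose proof (qpow_bounds (S n)).
      set (Q := q ^ S n) in *. set (z := q ^ j) in *.
      apply Rmult_lt_reg_l with ((1 - q) ^ 2); [nra|].
      replace ((1 - q) ^ 2 * (4 / (1 - q) ^ 2)) with 4 by (field; repeat split; nra).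
      replace ((1 - q) ^ 2 * (z / Q)) with ((1 - q) ^ 2 / Q * z) by (field; repeat split; nra).
      nra. }
    apply Rlt_le, exp_increasing, Rmult_lt_compat_l; assumption. }
  (* Induction on the number j of upward steps in k that bring lam * q^k below 4; [p_mono] handles
     each step. *)
  assert (H : forall j k, lam (S n) * q ^ (j + k) < 4 -> Rabs (p (S n) k) <= exp (K * (4 / (1 - q) ^ 2))).
  { induction j as [|j IH]; intros i Hi; [now apply small|].
    destruct (Rlt_or_le (lam (S n) * q ^ i) 4) as [L|L]; [now apply small|].
    eapply Rle_trans; [apply p_mono, L|]. apply IH. now rewrite Nat.add_succ_r. }
  destruct (pow_lt_1_zero q ltac:(rewrite Rabs_pos_eq; lra) (4 / lam (S n))) as [N HN].
  { apply Rdiv_lt_0_compat; [lra|apply lam_S_pos]. }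
  apply (H N). specialize (HN (N + k)%nat ltac:(lia)).
  rewrite Rabs_pos_eq in HN by (apply Rlt_le, qpow_bounds).
  pose proof (lam_S_pos n).
  apply Rmult_lt_compat_l with (r := lam (S n)) in HN; [|assumption].
  replace (lam (S n) * (4 / lam (S n))) with 4 in HN by (field; lra). exact HN.
Qed.

(** Absolute values in the q-difference equation. At k = 0 the convention [pred 0 = 0] only enlarges
    the right side. *)
Lemma p_lam_le (n k : nat) :
  lam n * q ^ k * Rabs (p n k) <= 2 * Rabs (p n k) + Rabs (p n (S k)) + Rabs (p n (pred k)).
Proof.
assert (Hl : 0 <= lam n) by (destruct n; [rewrite lam_0; lra|apply Rlt_le, lam_S_pos]).
pose proof (qpow_bounds k).
replace (lam n * q ^ k * Rabs (p n k)) with (Rabs (- lam n * q ^ k * p n k)).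
2: { rewrite !Rabs_mult, Rabs_Ropp, !(Rabs_pos_eq _) by lra. reflexivity. }
destruct k as [|k].
- replace (- lam n * q ^ 0 * p n 0) with (- lam n * p n 0) by (simpl; ring).
  rewrite p_qdifference_0, Rabs_mult, (Rabs_pos_eq (1 - q)) by lra.
  pose proof (Rabs_triang (p n 1) (- p n 0)). rewrite Rabs_Ropp in *.
  unfold Rminus at 2. pose proof (Rabs_pos (p n 1 + - p n 0)). simpl pred.
  pose proof (Rabs_pos (p n 0)). nra.
- rewrite p_qdifference_S. simpl pred.
  pose proof (qpow_S_lt1 k). pose proof (qpow_S_lt1 (S k)).
  pose proof (Rabs_triang (p n (S (S k))) (- p n (S k))).
  pose proof (Rabs_triang (p n (S k)) (- p n k)). rewrite !Rabs_Ropp in *.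
  eapply Rle_trans; [apply Rabs_triang|]. rewrite Rabs_Ropp, !Rabs_mult.
  rewrite !(Rabs_pos_eq (1 - _)) by lra.
  unfold Rminus in *.
  pose proof (Rabs_pos (p n (S (S k)) + - p n (S k))).
  pose proof (Rabs_pos (p n (S k) + - p n k)). nra.
Qed.

(** Dividing [p_lam_le] by lam n * q^k gains one factor q^n at the price of the neighbours of k, so
    the induction on r treats all k at once. *)
Lemma p_decay (r k : nat) : exists C, 0 < C /\ forall n, Rabs (p n k) <= C * (q ^ n) ^ r.
Proof.
revert k. induction r as [|r IH]; intros k.
- destruct p_bounded as [C [HC H]]. exists C. split; [exact HC|]. intros n. simpl. rewrite Rmult_1_r. apply H.
- destruct (IH k) as [C1 [P1 H1]]. destruct (IH (S k)) as [C2 [P2 H2]]. destruct (IH (pred k)) as [C3 [P3 H3]].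
  pose proof (qpow_bounds k) as Hk.
  set (C := (2 * C1 + C2 + C3) / ((1 - q) ^ 2 * q ^ k)).
  assert (PC : 0 < C) by (unfold C; apply Rdiv_lt_0_compat; [lra|apply Rmult_lt_0_compat; nra]).
  (* The summand 1 covers n = 0, where lam 0 = 0 gives no decay and p 0 k = 1. *)
  exists (1 + C). split; [lra|].
  intros [|n].
  + rewrite p_0, Rabs_R1. simpl (q ^ 0). rewrite pow1. lra.
  + pose proof (p_lam_le (S n) k) as L. pose proof (lam_S_ge n) as G.
    pose proof (qpow_bounds (S n)) as HQ.
    specialize (H1 (S n)); specialize (H2 (S n)); specialize (H3 (S n)).
    set (Q := q ^ S n) in *.
    assert (0 < Q ^ r) by (apply pow_lt; lra).
    pose proof (Rabs_pos (p (S n) k)).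
    assert (Hm : (1 - q) ^ 2 / Q * q ^ k * Rabs (p (S n) k) <= (2 * C1 + C2 + C3) * Q ^ r).
    { eapply Rle_trans; [|eapply Rle_trans; [exact L|]]; [|lra].
      apply Rmult_le_compat_r; [assumption|]. apply Rmult_le_compat_r; lra. }
    assert (E : C * Q ^ S r = (2 * C1 + C2 + C3) * Q ^ r * (Q / ((1 - q) ^ 2 * q ^ k)))
      by (unfold C; simpl; field; repeat split; nra).
    assert (0 < Q ^ S r) by (apply pow_lt; lra).
    apply Rle_trans with (C * Q ^ S r); [|lra]. rewrite E.
    replace (Rabs (p (S n) k)) with
      ((1 - q) ^ 2 / Q * q ^ k * Rabs (p (S n) k) * (Q / ((1 - q) ^ 2 * q ^ k))) by (field; repeat split; nra).
    apply Rmult_le_compat_r; [|exact Hm].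
    apply Rlt_le, Rdiv_lt_0_compat; [lra|]. apply Rmult_lt_0_compat; nra.
Qed.

(** Of two factors q^n from [p_decay], one absorbs the growth of h and the other remains for
    summability. *)
Lemma p_hw_decay (k : nat) : exists C, 0 < C /\ forall n, Rabs (p n k) * hw q n <= C * q ^ n.
Proof.
destruct (p_decay 2 k) as [C [HC H]]. exists (C / (1 - q)). split; [apply Rdiv_lt_0_compat; lra|].
intros n. pose proof (hw_pos n). pose proof (qpow_bounds n).
apply Rle_trans with (C * (q ^ n) ^ 2 * (/ (1 - q) / q ^ n)).
- apply Rmult_le_compat; [apply Rabs_pos|lra|apply H|apply hw_le].
- apply Req_le. field. lra.
Qed.

(** * Annihilators of the sequences alpha_k *)

Lemma ex_series_p_hw_bounded (k : nat) (phi : nat -> R) (B : R) :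
  (forall m, Rabs (phi m) <= B) -> ex_series (fun m => p m k * hw q m * phi m).
Proof.
intros Hphi. destruct (p_hw_decay k) as [C [HC H]].
apply (ex_series_le (V := R_CompleteNormedModule) _ (fun m => (C * B) * q ^ m)); [|now apply ex_series_geom_scal].
intros m. change (Rabs (p m k * hw q m * phi m) <= C * B * q ^ m).
rewrite !Rabs_mult. rewrite (Rabs_pos_eq (hw q m)) by apply Rlt_le, hw_pos.
replace (C * B * q ^ m) with (C * q ^ m * B) by ring.
apply Rmult_le_compat; [|apply Rabs_pos|apply H|apply Hphi].
apply Rmult_le_pos; [apply Rabs_pos|apply Rlt_le, hw_pos].
Qed.

(** This is h(m) times the operator R_1 - 1 acting on [phi] by the recurrence, in divergence form
    with zero flux below m = 0. *)
Definition wdiff (phi : nat -> R) (m : nat) : R :=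
  w m * (phi (S m) - phi m) - match m with O => 0 | S j => w j * (phi (S j) - phi j) end.

Lemma wdiff_p (k m : nat) : wdiff (fun n => p n k) m = - (1 + q) * q ^ k * hw q m * p m k.
Proof.
unfold wdiff. destruct m as [|m]; [rewrite p_difference_0|rewrite p_difference_S]; ring.
Qed.

(** Discrete Green identity: [wdiff] is symmetric up to a boundary term at the upper end. *)
Lemma wdiff_Green (phi psi : nat -> R) (N : nat) :
  sum_n (fun m => psi m * wdiff phi m - phi m * wdiff psi m) N =
  w N * (psi N * phi (S N) - psi (S N) * phi N) :> R.
Proof.
induction N as [|N IH].
- rewrite sum_n_0. unfold wdiff. ring.
- rewrite sum_n_S, IH. unfold wdiff. ring.
Qed.

Lemma wdiff_bounded (phi : nat -> R) (B : R) (m : nat) :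
  (forall m, Rabs (phi m) <= B) -> Rabs (wdiff phi m) <= 4 * ((1 + q) / (1 - q)) * B.
Proof.
intros H.
assert (HB : 0 <= B) by (eapply Rle_trans; [apply Rabs_pos|apply (H 0%nat)]).
assert (W : forall j, Rabs (w j * (phi (S j) - phi j)) <= 2 * ((1 + q) / (1 - q)) * B).
{ intros j. rewrite Rabs_mult. pose proof (w_bounds j). rewrite Rabs_pos_eq by lra.
  pose proof (Rabs_triang (phi (S j)) (- phi j)) as T. rewrite Rabs_Ropp in T.
  fold (phi (S j) - phi j) in T. pose proof (H j). pose proof (H (S j)).
  replace (2 * ((1 + q) / (1 - q)) * B) with ((1 + q) / (1 - q) * (2 * B)) by ring.
  apply Rmult_le_compat; [lra|apply Rabs_pos|lra|lra]. }
assert (Hq : 0 <= (1 + q) / (1 - q)) by (apply Rlt_le, Rdiv_lt_0_compat; lra).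
pose proof (Rmult_le_pos _ _ Hq HB).
unfold wdiff, Rminus at 1. eapply Rle_trans; [apply Rabs_triang|]. rewrite Rabs_Ropp.
pose proof (W m). destruct m as [|j]; [rewrite Rabs_R0; lra|]. pose proof (W j). lra.
Qed.

Lemma p_lim_n (k : nat) : is_lim_seq (fun n => p n k) 0.
Proof.
destruct (p_decay 1 k) as [C [HC H]].
apply is_lim_seq_abs_0.
apply is_lim_seq_le_le with (fun _ => 0) (fun n => C * q ^ n).
- intros n. split; [apply Rabs_pos|]. specialize (H n). now rewrite pow_1 in H.
- apply is_lim_seq_const.
- replace (Finite 0) with (Rbar_mult C 0) by (simpl; f_equal; ring).
  apply is_lim_seq_scal_l. apply is_lim_seq_geom. rewrite Rabs_pos_eq; lra.
Qed.

Definition annihilates (phi : nat -> R) : Prop :=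
  forall k, is_series (fun m => p m k * hw q m * phi m) 0.

(** Green's identity moves [wdiff] onto alpha_k, which is an eigenvector by [wdiff_p]. The boundary
    term vanishes in the limit since w and phi are bounded and p N k tends to 0. *)
Lemma annihilates_wdiff (phi : nat -> R) (B : R) (k : nat) :
  (forall m, Rabs (phi m) <= B) -> annihilates phi ->
  is_series (fun m => p m k * wdiff phi m) 0.
Proof.
intros HB H.
assert (bnd : is_lim_seq (fun N => w N * (p N k * phi (S N) - p (S N) k * phi N)) 0).
{ apply is_lim_seq_abs_0.
  apply is_lim_seq_le_le with (fun _ => 0)
    (fun N => (1 + q) / (1 - q) * B * (Rabs (p N k) + Rabs (p (S N) k))).
  - intros N. split; [apply Rabs_pos|]. rewrite Rabs_mult. pose proof (w_bounds N).
    rewrite (Rabs_pos_eq (w N)) by lra. rewrite Rmult_assoc.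
    apply Rmult_le_compat; [lra|apply Rabs_pos|lra|].
    unfold Rminus. eapply Rle_trans; [apply Rabs_triang|]. rewrite Rabs_Ropp, !Rabs_mult.
    pose proof (HB N). pose proof (HB (S N)). pose proof (Rabs_pos (p N k)). pose proof (Rabs_pos (p (S N) k)).
    nra.
  - apply is_lim_seq_const.
  - replace (Finite 0) with (Rbar_mult ((1 + q) / (1 - q) * B) (0 + 0)) by (simpl; f_equal; ring).
    apply is_lim_seq_scal_l. apply is_lim_seq_plus'.
    + apply (is_lim_seq_abs_0 (fun n => p n k)), p_lim_n.
    + apply (is_lim_seq_abs_0 (fun n => p (S n) k)). apply (is_lim_seq_incr_1 (fun n => p n k)), p_lim_n. }
apply is_series_ext_R with (fun m => (p m k * wdiff phi m - phi m * wdiff (fun n => p n k) m)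
  + (- (1 + q) * q ^ k) * (p m k * hw q m * phi m)).
{ intros m. rewrite wdiff_p. ring. }
apply is_series_plus_0.
- change (is_lim_seq (sum_n (fun m => p m k * wdiff phi m - phi m * wdiff (fun n => p n k) m)) 0).
  eapply is_lim_seq_ext; [|exact bnd]. intros N. symmetry. apply (wdiff_Green phi (fun n => p n k)).
- apply is_series_scal_0, H.
Qed.

Lemma p_sum_0_lim : is_lim_seq (fun N => sum_n (fun k => q ^ k * p 0 k) N) (/ (1 - q)).
Proof.
apply is_lim_seq_ext with (fun N => sum_n (fun k => q ^ k) N).
{ intros N. apply sum_n_ext_R. intros k. rewrite p_0. ring. }
apply is_series_geom. rewrite Rabs_pos_eq; lra.
Qed.

Lemma p_sum_S (n N : nat) :
  sum_n (fun k => q ^ k * p (S n) k) N = (1 - q ^ S N) * (p (S n) N - p (S n) (S N)) / lam (S n) :> R.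
Proof.
pose proof (lam_S_pos n). apply Rmult_eq_reg_l with (lam (S n)); [|lra].
rewrite p_qdifference_sum. field. lra.
Qed.

(** Orthogonality of R_(n+1) to R_0: the telescoped sum is a multiple of p N - p (N+1), and both
    values tend to 1. *)
Lemma p_sum_S_lim (n : nat) : is_lim_seq (fun N => sum_n (fun k => q ^ k * p (S n) k) N) 0.
Proof.
apply is_lim_seq_ext with (fun N => / lam (S n) * ((1 - q ^ S N) * (p (S n) N - p (S n) (S N)))).
{ intros N. rewrite p_sum_S. apply Rmult_comm. }
replace (Finite 0) with (Rbar_mult (/ lam (S n)) ((1 - 0) * (1 - 1))) by (simpl; f_equal; ring).
apply is_lim_seq_scal_l. apply is_lim_seq_mult'; apply is_lim_seq_minus'.
- apply is_lim_seq_const.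
- apply (is_lim_seq_incr_1 (fun N => q ^ N)), is_lim_seq_geom. rewrite Rabs_pos_eq; lra.
- apply p_lim.
- apply (is_lim_seq_incr_1 (p (S n))), p_lim.
Qed.

(** The majorant, uniform in N, for dominated convergence; the factor q^n comes from 1 / lam. *)
Lemma p_sum_S_bounded : exists C, forall n N,
  Rabs (sum_n (fun k => q ^ k * p (S n) k) N) <= C * q ^ n.
Proof.
destruct p_bounded as [C [HC H]]. exists (2 * C / (1 - q) ^ 2). intros n N.
rewrite p_sum_S. pose proof (lam_S_pos n). pose proof (lam_S_ge n).
pose proof (qpow_S_lt1 N). pose proof (qpow_S_lt1 n). pose proof (qpow_bounds n).
unfold Rdiv. rewrite !Rabs_mult, (Rabs_pos_eq (/ _)) by (apply Rlt_le, Rinv_0_lt_compat; lra).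
rewrite (Rabs_pos_eq (1 - _)) by lra.
assert (T : Rabs (p (S n) N - p (S n) (S N)) <= 2 * C).
{ unfold Rminus. eapply Rle_trans; [apply Rabs_triang|]. rewrite Rabs_Ropp.
  pose proof (H (S n) N). pose proof (H (S n) (S N)). lra. }
assert (I : / lam (S n) <= q ^ n / (1 - q) ^ 2).
{ assert (0 < (1 - q) ^ 2) by (apply pow_lt; lra).
  apply Rle_trans with (/ ((1 - q) ^ 2 / q ^ S n)).
  - apply Rinv_le_contravar; [apply Rdiv_lt_0_compat; lra|assumption].
  - replace (/ ((1 - q) ^ 2 / q ^ S n)) with (q ^ S n / (1 - q) ^ 2)
      by (set (Q := q ^ S n) in *; field; lra).
    apply Rmult_le_compat_r; [apply Rlt_le, Rinv_0_lt_compat; lra|]. simpl; nra. }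
replace (2 * C * / (1 - q) ^ 2 * q ^ n) with (2 * C * (q ^ n / (1 - q) ^ 2)) by (field; lra).
pose proof (Rabs_pos (p (S n) N - p (S n) (S N))).
apply Rmult_le_compat; [nra|apply Rlt_le, Rinv_0_lt_compat; lra| |exact I]. nra.
Qed.

Lemma annihilates_1_eq_0 (phi : nat -> R) (B : R) :
  (forall m, Rabs (phi m) <= B) -> annihilates phi -> phi 1%nat = phi 0%nat.
Proof.
intros HB H.
set (S_ := fun m N => sum_n (fun k => q ^ k * p m k) N).
assert (H0 : forall N, is_series (fun m => S_ m N * wdiff phi m) 0).
{ intros N.
  (* Only finitely many k are involved, so the sums over k and m are exchanged by linearity. *)
  apply is_series_ext_R with (fun m => sum_n (fun k => q ^ k * (p m k * wdiff phi m)) N).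
  - intros m. unfold S_.
    rewrite <- sum_n_scal_r. apply sum_n_ext_R. intros k. ring.
  - apply is_series_weighted_sum_0. intros k. now apply annihilates_wdiff with B. }
(* The term m = 0 is split off. Its coefficient tends to 1/(1-q), while the sum [T] of the others
   tends to 0; hence wdiff phi 0 = phi 1 - phi 0 is zero. *)
set (T := fun N m => S_ (S m) N * wdiff phi (S m)).
assert (HT : forall N, S_ 0%nat N * wdiff phi 0 = - Series (T N)).
{ intros N. pose proof (is_series_unique _ _ (H0 N)) as E.
  rewrite Series_incr_1 in E by (exists 0; apply H0). unfold T. lra. }
assert (LT : is_lim_seq (fun N => Series (T N)) 0).
{ destruct p_sum_S_bounded as [C HC].
  apply (is_lim_seq_Series_0 T (fun m => C * (4 * ((1 + q) / (1 - q)) * B) * q ^ m)).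
  - intros N m. unfold T. rewrite Rabs_mult.
    replace (C * (4 * ((1 + q) / (1 - q)) * B) * q ^ m) with ((C * q ^ m) * (4 * ((1 + q) / (1 - q)) * B)) by ring.
    apply Rmult_le_compat; [apply Rabs_pos|apply Rabs_pos|apply HC|now apply wdiff_bounded].
  - now apply ex_series_geom_scal.
  - intros m. unfold T. replace (Finite 0) with (Rbar_mult 0 (wdiff phi (S m))) by (simpl; f_equal; ring).
    apply is_lim_seq_scal_r. apply p_sum_S_lim. }
assert (L1 : is_lim_seq (fun N => S_ 0%nat N * wdiff phi 0) (/ (1 - q) * wdiff phi 0)).
{ apply (is_lim_seq_scal_r _ (wdiff phi 0) (/ (1 - q))). apply p_sum_0_lim. }
assert (L2 : is_lim_seq (fun N => S_ 0%nat N * wdiff phi 0) (- 0)).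
{ apply is_lim_seq_ext with (fun N => - Series (T N)); [intros N; now rewrite HT|].
  now apply (is_lim_seq_opp _ 0). }
apply is_lim_seq_unique in L1. apply is_lim_seq_unique in L2. rewrite L1 in L2.
injection L2 as E. unfold wdiff in E. rewrite w_0 in E.
assert (0 < / (1 - q)) by (apply Rinv_0_lt_compat; lra). nra.
Qed.

(* The bounded annihilators are stable under translation by the degree-one
   polynomial, phi |-> phi + wdiff phi / h, so phi 1 = phi 0 propagates. *)
Lemma annihilates_const (phi : nat -> R) (B : R) :
  (forall m, Rabs (phi m) <= B) -> annihilates phi -> forall n, phi n = phi 0%nat.
Proof.
intros HB H n.
(* The sequence is quantified inside the induction because the hypothesis is also applied to the
   translate [psi]. *)
enough (G : forall n phi B, (forall m, Rabs (phi m) <= B) -> annihilates phi ->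
  forall i, (i <= S n)%nat -> phi i = phi 0%nat) by (apply (G n phi B); auto).
clear n phi B HB H. induction n as [|n IH]; intros phi B HB H i Hi.
- destruct i as [|[|i]]; [reflexivity|now apply annihilates_1_eq_0 with B|lia].
- destruct (Nat.eq_dec i (S (S n))) as [->|Hne]; [|apply (IH phi B HB H); lia].
  set (psi := fun m => phi m + wdiff phi m / hw q m).
  assert (Hpsi : psi (S n) = psi 0%nat).
  { apply (IH psi (B + 4 * ((1 + q) / (1 - q)) * B)); [| |lia].
    - intros m. unfold psi. eapply Rle_trans; [apply Rabs_triang|].
      apply Rplus_le_compat; [apply HB|]. unfold Rdiv at 1. rewrite Rabs_mult.
      pose proof (hw_ge_1 m). pose proof (wdiff_bounded phi B m HB).
      rewrite (Rabs_pos_eq (/ _)) by (apply Rlt_le, Rinv_0_lt_compat; lra).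
      assert (/ hw q m <= 1) by (rewrite <- Rinv_1; apply Rinv_le_contravar; lra).
      pose proof (Rabs_pos (wdiff phi m)).
      apply Rle_trans with (Rabs (wdiff phi m) * 1); [now apply Rmult_le_compat_l|lra].
    - intros k. apply is_series_ext_R with (fun m => p m k * hw q m * phi m + p m k * wdiff phi m).
      { intros m. unfold psi. pose proof (hw_pos m). field. lra. }
      apply is_series_plus_0; [apply H|now apply annihilates_wdiff with B]. }
  (* As phi is already constant up to n+1, psi (n+1) = psi 0 reduces to w (n+1) * (phi (n+2) - phi
     0) = 0 after multiplying by h. *)
  unfold psi, wdiff in Hpsi.
  rewrite (IH phi B HB H (S n)), (IH phi B HB H n), (IH phi B HB H 1%nat) in Hpsi by lia.
  pose proof (w_bounds (S n)). pose proof (hw_pos (S n)).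
  apply Rmult_eq_reg_l with (w (S n) / hw q (S n)).
  + unfold Rdiv in *. nra.
  + apply Rgt_not_eq, Rdiv_lt_0_compat; lra.
Qed.

(** * Derivations *)

Section Algebra.

Context (g : nat -> nat -> nat -> R) (hg : is_linearization q g).

(** * Orthogonality and the coefficients g(n,n;0) *)

Lemma natdist_diag (n : nat) : natdist n n = 0%nat.
Proof. unfold natdist; lia. Qed.

Lemma natdist_pos (m n : nat) : m <> n -> (0 < natdist m n)%nat.
Proof. unfold natdist; lia. Qed.

Lemma p_product_sum (m n N : nat) :
  sum_n (fun k => q ^ k * (p m k * p n k)) N =
  sum_n_m (fun j => g m n j * sum_n (fun k => q ^ k * p j k) N) (natdist m n) (m + n) :> R.
Proof.
induction N as [|N IH].
- rewrite sum_n_0. unfold p at 1 2. rewrite hg.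
  etransitivity; [symmetry; apply (sum_n_m_mult_l (K := R_Ring))|].
  apply sum_n_m_ext. intros j. rewrite sum_n_0. unfold mult, p; simpl; ring.
- rewrite sum_n_S, IH. unfold p at 2 3. rewrite hg.
  etransitivity; [apply (f_equal (Rplus _)); symmetry; apply (sum_n_m_mult_l (K := R_Ring))|].
  etransitivity; [symmetry; apply (sum_n_m_plus (G := R_AbelianMonoid))|].
  apply sum_n_m_ext. intros j. rewrite sum_n_S. 
  change (g m n j * sum_n (fun k => q ^ k * p j k) N + q ^ S N * (g m n j * p j (S N))
   = g m n j * (sum_n (fun k => q ^ k * p j k) N + q ^ S N * p j (S N)) :> R). ring.
Qed.

(** After linearization only the R_0 term survives summation against q^k, and R_0 is in the range of
    the expansion only if |m - n| = 0. *)
Lemma p_product_lim (m n : nat) :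
  is_lim_seq (fun N => sum_n (fun k => q ^ k * (p m k * p n k)) N)
    ((if Nat.eqb m n then g n n 0 / (1 - q) else 0) : R).
Proof.
set (l := fun j => g m n j * match j with O => / (1 - q) | S _ => 0 end).
assert (H : is_lim_seq (fun N => sum_n (fun k => q ^ k * (p m k * p n k)) N)
   (sum_n_m l (natdist m n) (m + n))).
{ eapply is_lim_seq_ext; [intros N; symmetry; apply p_product_sum|].
  apply (is_lim_seq_sum_n_m (fun j N => g m n j * sum_n (fun k => q ^ k * p j k) N)).
  intros [|j]; unfold l.
  - apply (is_lim_seq_scal_l _ (g m n 0%nat) (/ (1 - q))), p_sum_0_lim.
  - apply (is_lim_seq_scal_l _ (g m n (S j)) 0), p_sum_S_lim. }
destruct (Nat.eqb_spec m n) as [->|Hmn].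
- rewrite natdist_diag, sum_n_m_head in H; [exact H|]. intros j. unfold l. ring.
- rewrite sum_n_m_0_R in H; [exact H|]. intros j Hj. pose proof (natdist_pos m n Hmn).
  destruct j as [|j]; [lia|unfold l; ring].
Qed.

(** The multiplication operator R_1 - 1 is symmetric: pairing it with R_n and R_(n+1) is computed
    once through the recurrence of R_(n+1) ([L1]) and once through that of R_n ([L2]). Comparing the
    limits relates the squared norms, which are g(n,n;0)/(1-q). *)
Lemma linearization_diag_step (n : nat) : hw q (S n) * g (S n) (S n) 0 = hw q n * g n n 0.
Proof.
set (X := fun m n => if Nat.eqb m n then g n n 0 / (1 - q) else 0).
set (s := fun m n N => sum_n (fun k => q ^ k * (p m k * p n k)) N : R).
assert (Xd : forall j, X j j = g j j 0%nat / (1 - q)) by (intros; unfold X; now rewrite Nat.eqb_refl).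
assert (Xo : forall i j, i <> j -> X i j = 0)
  by (intros i j H; unfold X; now rewrite (proj2 (Nat.eqb_neq i j) H)).
assert (HX : forall i j, is_lim_seq (s i j) (X i j)).
{ intros i j. apply p_product_lim. }
set (Y := fun N => sum_n (fun k => q ^ k * (- (1 + q) * q ^ k * p n k * p (S n) k)) N : R).
assert (L1 : is_lim_seq Y (w n * X n n / hw q (S n))).
{ apply is_lim_seq_ext with (fun N => / hw q (S n) *
    (w (S n) * (s (S (S n)) n N - s (S n) n N) - w n * (s (S n) n N - s n n N))).
  - intros N. unfold Y, s. pose proof (hw_pos (S n)). induction N as [|N IH].
    + rewrite !sum_n_0.
      replace (q ^ 0 * (- (1 + q) * q ^ 0 * p n 0 * p (S n) 0)) with
       (q ^ 0 * (p n 0 * (- (1 + q) * q ^ 0 * hw q (S n) * p (S n) 0)) / hw q (S n)) by (field; lra).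
      rewrite <- p_difference_S. field. lra.
    + rewrite !sum_n_S, <- IH.
      replace (q ^ S N * (- (1 + q) * q ^ S N * p n (S N) * p (S n) (S N))) with
       (q ^ S N * (p n (S N) * (- (1 + q) * q ^ S N * hw q (S n) * p (S n) (S N))) / hw q (S n)) by (field; lra).
      rewrite <- p_difference_S. field. lra.
  - replace (w n * X n n / hw q (S n)) with
      (/ hw q (S n) * (w (S n) * (X (S (S n)) n - X (S n) n) - w n * (X (S n) n - X n n)))
      by (rewrite (Xo (S (S n)) n), (Xo (S n) n) by lia; unfold Rdiv; ring).
    apply (is_lim_seq_scal_l _ (/ hw q (S n)) (w (S n) * (X (S (S n)) n - X (S n) n) - w n * (X (S n) n - X n n))).
    apply is_lim_seq_minus'.
    + apply (is_lim_seq_scal_l _ (w (S n)) (X (S (S n)) n - X (S n) n)). now apply is_lim_seq_minus'.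
    + apply (is_lim_seq_scal_l _ (w n) (X (S n) n - X n n)). now apply is_lim_seq_minus'. }
assert (L2 : is_lim_seq Y (w n * X (S n) (S n) / hw q n)).
{ apply is_lim_seq_ext with (fun N => / hw q n *
    (w n * (s (S n) (S n) N - s n (S n) N) - match n with O => 0 | S j => w j * (s n (S n) N - s j (S n) N) end)).
  - intros N. unfold Y, s. pose proof (hw_pos n). induction N as [|N IH].
    + rewrite !sum_n_0.
      replace (q ^ 0 * (- (1 + q) * q ^ 0 * p n 0 * p (S n) 0)) with
       (q ^ 0 * (p (S n) 0%nat * (- (1 + q) * q ^ 0 * hw q n * p n 0)) / hw q n) by (field; lra).
      rewrite <- wdiff_p. unfold wdiff. destruct n; rewrite ?sum_n_0; field; lra.
    + rewrite !sum_n_S, <- IH.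
      replace (q ^ S N * (- (1 + q) * q ^ S N * p n (S N) * p (S n) (S N))) with
       (q ^ S N * (p (S n) (S N) * (- (1 + q) * q ^ S N * hw q n * p n (S N))) / hw q n) by (field; lra).
      rewrite <- wdiff_p. unfold wdiff. destruct n; rewrite ?sum_n_S; field; lra.
  - replace (w n * X (S n) (S n) / hw q n) with
      (/ hw q n * (w n * (X (S n) (S n) - X n (S n)) - match n with O => 0 | S j => w j * (X n (S n) - X j (S n)) end)).
    2:{ rewrite (Xo n (S n)) by lia. destruct n; [|rewrite (Xo n (S (S n))) by lia]; unfold Rdiv; ring. }
    apply (is_lim_seq_scal_l _ (/ hw q n) (w n * (X (S n) (S n) - X n (S n)) - match n with O => 0 | S j => w j * (X n (S n) - X j (S n)) end)).
    apply is_lim_seq_minus'.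
    + apply (is_lim_seq_scal_l _ (w n) (X (S n) (S n) - X n (S n))). now apply is_lim_seq_minus'.
    + destruct n as [|j]; [apply is_lim_seq_const|].
      apply (is_lim_seq_scal_l _ (w j) (X (S j) (S (S j)) - X j (S (S j)))). now apply is_lim_seq_minus'. }
apply is_lim_seq_unique in L1. apply is_lim_seq_unique in L2. rewrite L1 in L2. injection L2 as E.
rewrite !Xd in E. pose proof (w_bounds n). pose proof (hw_pos n). pose proof (hw_pos (S n)).
apply Rmult_eq_reg_l with (w n / (1 - q) / hw q n / hw q (S n)).
- transitivity (w n * (g (S n) (S n) 0%nat / (1 - q)) / hw q n); [field; lra|].
  rewrite <- E. field; lra.
- apply Rgt_not_eq. do 3 (apply Rdiv_lt_0_compat; [|lra]). lra.
Qed.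

(** This normalization of h is what makes [delta 0] the unit of the convolution. *)
Lemma linearization_diag (n : nat) : g n n 0 = / hw q n.
Proof.
assert (H : hw q n * g n n 0%nat = 1).
{ induction n as [|n IH]; [|now rewrite linearization_diag_step].
  pose proof (hg 0%nat 0%nat 1) as E. rewrite natdist_diag, sum_n_n, !Rleg_0 in E. rewrite hw_0, Rmult_1_l.
    rewrite Rmult_1_r in E. symmetry. rewrite Rmult_1_r in E. exact E. }
pose proof (hw_pos n). apply Rmult_eq_reg_l with (hw q n); [|lra]. rewrite H. field. lra.
Qed.

(** * Bounded functionals on real summable sequences *)

Definition delta (m k : nat) : R := if Nat.eqb k m then 1 else 0.

Definition trunc (f : nat -> R) (N k : nat) : R := if Nat.leb k N then f k else 0.

Definition summable (f : nat -> R) : Prop := ex_series (fun k => Rabs (f k) * hw q k).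

Lemma summable_trunc (f : nat -> R) (N : nat) : summable (trunc f N).
Proof.
apply ex_series_finite with N. intros k Hk. unfold trunc.
rewrite (proj2 (Nat.leb_gt k N) Hk), Rabs_R0. ring.
Qed.

Lemma summable_delta (m : nat) : summable (delta m).
Proof.
apply ex_series_finite with m. intros k Hk. unfold delta.
rewrite (proj2 (Nat.eqb_neq k m)) by lia. rewrite Rabs_R0. ring.
Qed.

Lemma norm_delta (m : nat) : Series (fun k => Rabs (delta m k) * hw q k) = hw q m.
Proof.
rewrite (Series_single m).
- unfold delta. rewrite Nat.eqb_refl, Rabs_R1. ring.
- intros k Hk. unfold delta. rewrite (proj2 (Nat.eqb_neq k m) Hk), Rabs_R0. ring.
Qed.

Lemma summable_p (k : nat) : summable (fun n => p n k).
Proof.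
destruct (p_hw_decay k) as [C [HC H]].
apply (ex_series_le (V := R_CompleteNormedModule) _ (fun n => C * q ^ n)); [|now apply ex_series_geom_scal].
intros n. change (Rabs (Rabs (p n k) * hw q n) <= C * q ^ n).
rewrite Rabs_mult, Rabs_Rabsolu, (Rabs_pos_eq (hw q n)) by apply Rlt_le, hw_pos. apply H.
Qed.

Lemma summable_scal (c : R) (f : nat -> R) : summable f -> summable (fun k => c * f k).
Proof.
intros H. apply (ex_series_ext (fun k => Rabs c * (Rabs (f k) * hw q k))).
- intros k. change (Rabs c * (Rabs (f k) * hw q k) = Rabs (c * f k) * hw q k). rewrite Rabs_mult. ring.
- apply (ex_series_scal (V := R_NormedModule) (Rabs c)), H.
Qed.

(* Such a functional is represented by the bounded sequence Lam (delta m) / h m. *)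
Lemma functional_zero (Lam : (nat -> R) -> R) (K : R) :
  (forall f1 f2, summable f1 -> summable f2 -> Lam (fun k => f1 k + f2 k) = Lam f1 + Lam f2) ->
  (forall c f, summable f -> Lam (fun k => c * f k) = c * Lam f) ->
  (forall f, summable f -> Rabs (Lam f) <= K * Series (fun k => Rabs (f k) * hw q k)) ->
  (forall k, Lam (fun n => p n k) = 0) ->
  Lam (delta 0) = 0 ->
  forall f, summable f -> Lam f = 0.
Proof.
intros Hadd Hscal Hbd Hp H0.
assert (Hrep : forall f, summable f -> is_series (fun m => f m * Lam (delta m)) (Lam f)).
{ intros f Hf.
  assert (Htr : forall N, sum_n (fun m => f m * Lam (delta m)) N = Lam (trunc f N) :> R).
  { induction N as [|N IH].
    - rewrite sum_n_0, <- Hscal by apply summable_delta. f_equal. extensionality k.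
      unfold trunc, delta. destruct k; simpl; ring.
    - rewrite sum_n_S, IH, <- Hscal by apply summable_delta.
      rewrite <- Hadd by (apply summable_trunc || apply summable_scal, summable_delta).
      f_equal. extensionality k. unfold trunc, delta.
      destruct (Nat.leb_spec k N), (Nat.leb_spec k (S N)), (Nat.eqb_spec k (S N)); subst; try lia; ring. }
  change (is_lim_seq (sum_n (fun m => f m * Lam (delta m))) (Lam f)).
  apply is_lim_seq_ext with (fun N => Lam (trunc f N)); [intros; now rewrite Htr|].
  (* The remainders tend to 0 in norm by dominated convergence, so boundedness of [Lam] gives the
     limit of Lam (trunc f N). *)
  set (r := fun N k => f k - trunc f N k).
  assert (Hr0 : forall N k, Rabs (r N k) <= Rabs (f k)).
  { intros N k. unfold r, trunc. destruct (Nat.leb k N).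
    - rewrite Rminus_diag, Rabs_R0. apply Rabs_pos.
    - rewrite Rminus_0_r. lra. }
  assert (Hr : forall N, summable (r N)).
  { intros N. apply (ex_series_le (V := R_CompleteNormedModule) _ (fun k => Rabs (f k) * hw q k)); [|exact Hf].
    intros k. change (Rabs (Rabs (r N k) * hw q k) <= Rabs (f k) * hw q k).
    rewrite Rabs_mult, Rabs_Rabsolu, (Rabs_pos_eq (hw q k)) by apply Rlt_le, hw_pos.
    apply Rmult_le_compat_r; [apply Rlt_le, hw_pos|apply Hr0]. }
  assert (Er : forall N, Lam (trunc f N) = Lam f - Lam (r N)).
  { intros N. enough (Lam f = Lam (r N) + Lam (trunc f N)) by lra.
    rewrite <- Hadd by (apply Hr || apply summable_trunc). f_equal. extensionality k. unfold r. ring. }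
  apply is_lim_seq_ext with (fun N => Lam f - Lam (r N)); [intros; now rewrite Er|].
  replace (Finite (Lam f)) with (Finite (Lam f - 0)) by (f_equal; ring).
  apply is_lim_seq_minus'; [apply is_lim_seq_const|].
  apply is_lim_seq_abs_0.
  apply is_lim_seq_le_le with (fun _ => 0) (fun N => K * Series (fun k => Rabs (r N k) * hw q k)).
  - intros N. split; [apply Rabs_pos|apply Hbd, Hr].
  - apply is_lim_seq_const.
  - replace (Finite 0) with (Rbar_mult K 0) by (simpl; f_equal; ring).
    apply is_lim_seq_scal_l.
    apply (is_lim_seq_Series_0 (fun N k => Rabs (r N k) * hw q k) (fun k => Rabs (f k) * hw q k)).
    + intros N k. rewrite Rabs_mult, Rabs_Rabsolu, (Rabs_pos_eq (hw q k)) by apply Rlt_le, hw_pos.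
      apply Rmult_le_compat_r; [apply Rlt_le, hw_pos|apply Hr0].
    + exact Hf.
    + intros k. apply is_lim_seq_ext_loc with (fun _ => 0); [|apply is_lim_seq_const].
      exists k. intros N HN. unfold r, trunc. rewrite (proj2 (Nat.leb_le k N) HN), Rminus_diag, Rabs_R0. ring. }
set (phi := fun m => Lam (delta m) / hw q m).
assert (Hphi : forall m, Rabs (phi m) <= K).
{ intros m. pose proof (Hbd _ (summable_delta m)) as B. rewrite norm_delta in B.
  pose proof (hw_pos m). unfold phi, Rdiv. rewrite Rabs_mult, (Rabs_pos_eq (/ _)) by (apply Rlt_le, Rinv_0_lt_compat; lra).
  apply Rmult_le_reg_r with (hw q m); [assumption|]. rewrite Rmult_assoc, Rinv_l by lra. lra. }
assert (Hann : annihilates phi).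
{ intros k. rewrite <- (Hp k).
  apply is_series_ext_R with (fun m => p m k * Lam (delta m)).
  - intros m. unfold phi. pose proof (hw_pos m). field. lra.
  - apply (Hrep (fun n => p n k)), summable_p. }
assert (Hd : forall m, Lam (delta m) = 0).
{ intros m. pose proof (annihilates_const phi K Hphi Hann m) as E. unfold phi in E.
  rewrite H0, hw_0 in E. pose proof (hw_pos m).
  replace (Lam (delta m)) with (Lam (delta m) / hw q m * hw q m) by (field; lra). rewrite E. field. }
intros f Hf. pose proof (is_series_unique _ _ (Hrep f Hf)) as E.
rewrite <- E. apply is_series_unique.
apply is_series_ext_R with (fun _ => 0); [intros m; rewrite Hd; ring|apply is_series_0].
Qed.

(** * Convolution with alpha_k and with the unit *)

Lemma Tr_RtoC (n m : nat) (f : nat -> R) :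
  Tr g n (fun k => RtoC (f k)) m = RtoC (sum_n_m (fun k => g m n k * f k) (natdist m n) (m + n)).
Proof.
unfold Tr. rewrite <- sum_n_m_RtoC. apply sum_n_m_ext. intros k. symmetry. apply RtoC_mult.
Qed.

(** Linearization read backwards: alpha_k is a common eigenvector of all translations. *)
Lemma Tr_p (n m k : nat) : Tr g n (fun j => RtoC (p j k)) m = RtoC (p m k * p n k).
Proof. rewrite Tr_RtoC. f_equal. unfold p. symmetry. apply hg. Qed.

Lemma conv_p (k n : nat) (psi : nat -> C) :
  conv q g (fun j => RtoC (p j k)) psi n =
  Cmult (RtoC (p n k)) (csum (fun m => Cmult (RtoC (p m k * hw q m)) (psi m))).
Proof.
rewrite <- csum_scal. unfold conv. f_equal. extensionality m.
rewrite Tr_p, !RtoC_mult. ring.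
Qed.

(** The translate of [delta 0] by n at m is nonzero only for |m - n| = 0, where it is g(n,n;0) =
    1/h(n) and cancels the weight. *)
Lemma conv_delta_0 (n : nat) (psi : nat -> C) : conv q g (fun j => RtoC (delta 0 j)) psi n = psi n.
Proof.
assert (E : forall m, Tr g n (fun j => RtoC (delta 0 j)) m = RtoC (if Nat.eqb m n then / hw q n else 0)).
{ intros m. rewrite Tr_RtoC. f_equal. destruct (Nat.eqb_spec m n) as [->|Hmn].
  - rewrite natdist_diag, sum_n_m_head, linearization_diag; unfold delta; simpl; intros; ring.
  - apply sum_n_m_0_R. intros j Hj. pose proof (natdist_pos m n Hmn).
    destruct j as [|j]; [lia|]. unfold delta; simpl; ring. }
pose proof (hw_pos n).
unfold conv, csum. rewrite (Series_single n), (Series_single n).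
- rewrite E, Nat.eqb_refl. apply injective_projections; simpl; field; lra.
- intros m Hm. rewrite E, (proj2 (Nat.eqb_neq m n) Hm). unfold Cmult, RtoC; simpl; ring.
- intros m Hm. rewrite E, (proj2 (Nat.eqb_neq m n) Hm). unfold Cmult, RtoC; simpl; ring.
Qed.

Lemma in_l1_RtoC (f : nat -> R) : in_l1 q (fun k => RtoC (f k)) <-> summable f.
Proof.
unfold in_l1, summable. split; apply ex_series_ext; intros k; now rewrite Cmod_R.
Qed.

(** The m = 0 term is 1 and the others are weighted squares. Positivity permits division by this
    constant in [derivation_p]. *)
Lemma Series_p_self_pos (k : nat) : 0 < Series (fun m => p m k * hw q m * p m k).
Proof.
assert (Ex : ex_series (fun m => p m k * hw q m * p m k)).
{ destruct p_bounded as [C [HC H]]. apply ex_series_p_hw_bounded with C. intros m. apply H. }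
rewrite Series_incr_1, p_0, hw_0 by exact Ex.
assert (0 <= Series (fun m => p (S m) k * hw q (S m) * p (S m) k)); [|lra].
rewrite <- (is_series_unique _ _ is_series_0).
apply Series_le; [|now apply (ex_series_incr_1 (fun m => p m k * hw q m * p m k))].
intros m. split; [lra|]. pose proof (hw_pos (S m)).
replace (p (S m) k * hw q (S m) * p (S m) k) with (hw q (S m) * (p (S m) k * p (S m) k)) by ring.
apply Rmult_le_pos; [lra|apply Rle_0_sqr].
Qed.

(** * Vanishing of bounded derivations *)

Context (D : (nat -> C) -> nat -> C) (HD : bounded_derivation q g D).

(* The convolution square of alpha = (p n k)_n is c alpha, so alpha / c is an
   idempotent; with s = <alpha, D alpha> the derivation rule reads
   c D alpha = 2 s alpha, and pairing it with alpha gives c s = 2 c s. *)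
Lemma derivation_p (k n : nat) : D (fun j => RtoC (p j k)) n = RtoC 0.
Proof.
destruct HD as [_ [_ [Hscal [_ Hder]]]].
set (al := fun j => RtoC (p j k)).
assert (Hal : in_l1 q al) by (apply in_l1_RtoC, summable_p).
set (c := Series (fun m => p m k * hw q m * p m k)).
set (s := csum (fun m => Cmult (RtoC (p m k * hw q m)) (D al m))).
assert (Hc : RtoC c <> RtoC 0).
{ intros E. apply RtoC_inj in E. pose proof (Series_p_self_pos k). unfold c in E. lra. }
assert (Haa : conv q g al al = fun j => Cmult (RtoC c) (al j)).
{ extensionality j. unfold al at 1. rewrite conv_p.
  replace (csum _) with (RtoC c); [apply Cmult_comm|].
  rewrite <- (Cmult_1_r (RtoC c)). unfold c. rewrite <- csum_RtoC_scal. f_equal. extensionality m.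
  unfold al. rewrite (RtoC_mult _ (p m k)). ring. }
assert (HDal : forall j, Cmult (RtoC c) (D al j) = Cmult (RtoC 2) (Cmult (RtoC (p j k)) s)).
{ intros j. rewrite <- Hscal by exact Hal. rewrite <- Haa, Hder by exact Hal.
  unfold lact, ract. unfold al at 1 3. rewrite conv_p. fold s.
  replace (RtoC 2) with (Cplus (RtoC 1) (RtoC 1)) by (rewrite <- RtoC_plus; f_equal; ring). ring. }
assert (Hs : s = RtoC 0).
{ assert (E : Cmult (RtoC c) s = Cmult (RtoC c) (Cmult (RtoC 2) s)).
  { unfold s at 1. rewrite <- csum_scal. unfold c at 2. rewrite <- csum_RtoC_scal. f_equal. extensionality m.
    replace (Cmult (RtoC c) (Cmult (RtoC (p m k * hw q m)) (D al m)))
      with (Cmult (RtoC (p m k * hw q m)) (Cmult (RtoC c) (D al m))) by ring.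
    rewrite HDal, (RtoC_mult _ (p m k)). ring. }
  apply (f_equal (Cmult (Cinv (RtoC c)))) in E. rewrite !Cmult_assoc, Cinv_l, !Cmult_1_l in E by exact Hc.
  replace s with (Cminus (Cmult (RtoC 2) s) s) by
    (replace (RtoC 2) with (Cplus (RtoC 1) (RtoC 1)) by (rewrite <- RtoC_plus; f_equal; ring); ring).
  rewrite <- E. ring. }
rewrite <- (Cmult_1_l (D al n)), <- (Cinv_l (RtoC c)), <- Cmult_assoc, HDal, Hs by exact Hc. ring.
Qed.

(** The unit e is idempotent and acts as the identity, so the derivation rule reads D e = D e + D
    e. *)
Lemma derivation_delta_0 (n : nat) : D (fun j => RtoC (delta 0 j)) n = RtoC 0.
Proof.
destruct HD as [_ [_ [_ [_ Hder]]]].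
set (e := fun j => RtoC (delta 0 j)).
assert (He : in_l1 q e) by (apply in_l1_RtoC, summable_delta).
pose proof (Hder e e He He n) as E.
assert (Ee : conv q g e e = e) by (extensionality j; apply conv_delta_0).
unfold lact, ract in E. rewrite Ee in E. unfold e at 2 4 in E. rewrite conv_delta_0 in E.
replace (D e n) with (Cminus (Cplus (D e n) (D e n)) (D e n)) by ring. rewrite <- E. ring.
Qed.

Lemma derivation_RtoC (f : nat -> R) (n : nat) : summable f -> D (fun j => RtoC (f j)) n = RtoC 0.
Proof.
intros Hf. pose proof HD as [_ [Hadd [Hscal [[K HK] _]]]].
assert (A : forall f1 f2, summable f1 -> summable f2 ->
  D (fun k => RtoC (f1 k + f2 k)) n = Cplus (D (fun k => RtoC (f1 k)) n) (D (fun k => RtoC (f2 k)) n)).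
{ intros f1 f2 H1 H2. rewrite <- Hadd by now apply in_l1_RtoC. f_equal. extensionality k. apply RtoC_plus. }
assert (S : forall c f, summable f ->
  D (fun k => RtoC (c * f k)) n = Cmult (RtoC c) (D (fun k => RtoC (f k)) n)).
{ intros c f1 H1. rewrite <- Hscal by now apply in_l1_RtoC. f_equal. extensionality k. apply RtoC_mult. }
assert (B : forall f, summable f ->
  Cmod (D (fun k => RtoC (f k)) n) <= K * Series (fun k => Rabs (f k) * hw q k)).
{ intros f1 H1. replace (Series _) with (l1norm q (fun k => RtoC (f1 k))); [apply HK; now apply in_l1_RtoC|].
  apply Series_ext. intros k. now rewrite Cmod_R. }
assert (P : forall z : C, Rabs (fst z) <= Cmod z /\ Rabs (snd z) <= Cmod z).
{ intros z. pose proof (Rmax_Cmod z). pose proof (Rmax_l (Rabs (fst z)) (Rabs (snd z))).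
  pose proof (Rmax_r (Rabs (fst z)) (Rabs (snd z))). lra. }
(* For fixed n the real and imaginary parts of f |-> D f n are real bounded functionals on real
   sequences, as [functional_zero] requires. *)
apply injective_projections.
- apply (functional_zero (fun f => fst (D (fun k => RtoC (f k)) n)) K); [| | | | |exact Hf].
  + intros f1 f2 H1 H2. now rewrite A.
  + intros c f1 H1. rewrite S by exact H1. simpl. ring.
  + intros f1 H1. eapply Rle_trans; [apply P|now apply B].
  + intros k. now rewrite derivation_p.
  + now rewrite derivation_delta_0.
- apply (functional_zero (fun f => snd (D (fun k => RtoC (f k)) n)) K); [| | | | |exact Hf].
  + intros f1 f2 H1 H2. now rewrite A.
  + intros c f1 H1. rewrite S by exact H1. simpl. ring.
  + intros f1 H1. eapply Rle_trans; [apply P|now apply B].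
  + intros k. now rewrite derivation_p.
  + now rewrite derivation_delta_0.
Qed.

Lemma derivation_zero (f : nat -> C) (n : nat) : in_l1 q f -> D f n = RtoC 0.
Proof.
intros Hf. pose proof HD as [_ [Hadd [Hscal _]]].
assert (H12 : summable (fun k => fst (f k)) /\ summable (fun k => snd (f k))).
{ split; apply (ex_series_le (V := R_CompleteNormedModule) _ (fun k => Cmod (f k) * hw q k)); try exact Hf;
  intros k; pose proof (Rmax_Cmod (f k)); pose proof (Rmax_l (Rabs (fst (f k))) (Rabs (snd (f k))));
  pose proof (Rmax_r (Rabs (fst (f k))) (Rabs (snd (f k))));
  unfold norm; simpl; unfold abs; simpl;
  rewrite Rabs_mult, Rabs_Rabsolu, (Rabs_pos_eq (hw q k)) by apply Rlt_le, hw_pos;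
  apply Rmult_le_compat_r; try (apply Rlt_le, hw_pos); lra. }
destruct H12 as [H1 H2].
replace f with (fun k => Cplus (RtoC (fst (f k))) (Cmult Ci (RtoC (snd (f k))))).
- rewrite Hadd, Hscal, !derivation_RtoC; try assumption; try now apply in_l1_RtoC.
  + ring.
  + unfold in_l1. eapply ex_series_ext; [|exact H2]. intros k. cbv beta.
    rewrite Cmod_mult, Cmod_Ci, Cmod_R, Rmult_1_l. reflexivity.
- extensionality k. symmetry. apply injective_projections; simpl; ring.
Qed.

End Algebra.

End LittleQLegendre.

Theorem theorem4p4 (q : R) (hq : 0 < q < 1) (g : nat -> nat -> nat -> R)
  (hg : is_linearization q g) :
  weakly_amenable q g.
Proof.
(* D vanishes on the whole algebra and both module actions coincide, so x = 0 implements it. *)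
intros D HD. exists (fun _ => RtoC 0). split.
- exists 0. intros k. rewrite Cmod_0. lra.
- intros f Hf n. rewrite (derivation_zero q hq g hg D HD f n Hf). unfold lact, ract. ring.
Qed.
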